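(* Consider a generalized branching random walk (GBRW) with branching rules $\{p_{n,k}\}_{n\ge 0,k\ge 1}$ and displacement laws $\{G_{n,k}\}_{n\ge 0,k\ge 1}$, where $G_{n,k}$ is a distribution function on $\mathbb{R}^k$ all of whose one-dimensional marginals equal $g_{n,k}$, and put $\bar g_{n,k}=1-g_{n,k}$. Assume: (B1) there is an integer $k_0>1$ such that $p_{n,k}=0$ for all $n$ and all $k\notin\{1,\dots,k_0\}$; (B2) there is a real number $m_0>1$ such that $\inf_n\sum_{k=1}^{k_0}kp_{n,k}>m_0$; and, where in the next three assumptions $(n,k)$ ranges over those pairs with $p_{n,k}\neq 0$: (MT1) for some fixed $\epsilon_0<\min\{\frac14\log m_0,\,1\}$ there exists $x_0\in\mathbb{R}$ such that $\bar g_{n,k}(x_0)\ge 1-\epsilon_0$ for all $n,k$; (MT2) there exist $a>0$ and $M_0>0$ such that $\bar g_{n,k}(x+M)\le e^{-aM}\bar g_{n,k}(x)$ for all $n,k$, all $M>M_0$ and all $x\ge 0$; (GT) for every $\eta_1>0$ there exists $B>0$ such that $G_{n,k}(B,\dots,B)\ge 1-\eta_1$ and $G_{n,k}([-B,\infty)^k)\ge 1-\eta_1$ for all $n,k$. Let $F_n$ be the distribution function of the maximal position $\mathcal{M}_n$ of the particles alive at time $n$, and $Med(F_n)$ the median of $F_n$. Then the family of recentered maxima distributions $\{F_n(\cdot-Med(F_n))\}_{n\ge 0}$ is tight, i.e. the laws of the random variables $\mathcal{M}_n-Med(F_n)$, $n\ge 0$, form a tight family.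
   Context: GBRW: the $p_{n,k}$ are nonnegative reals with $\sum_{k\ge1}p_{n,k}=1$ and $\sum_{k\ge 1}kp_{n,k}<\infty$ for each $n\ge 0$; the $G_{n,k}$ are distribution functions on $\mathbb{R}^k$. At time $0$ there is one particle at location $0$. A particle $v$ alive at time $n$ at location $S_v$ dies at time $n+1$ and gives birth to a random number $K_v\ge 1$ of offspring, located at $S_v+X_{v,1},\dots,S_v+X_{v,K_v}$. The random vectors $(K_v,X_{v,1},\dots,X_{v,K_v})$, indexed by all particles $v$, are independent, and for $v$ in generation $n$, conditionally on the locations of all particles up to time $n$, $P(K_v=k)=p_{n,k}$ and, given $K_v=k$, $(X_{v,1},\dots,X_{v,k})$ has joint distribution function $G_{n,k}$. $\mathbb{D}_n$ is the set of particles alive at time $n$ and $\mathcal{M}_n=\max_{v\in\mathbb{D}_n}S_v$. For measurable $A\subset\mathbb{R}^k$, $G_{n,k}(A)=\int_A d^kG_{n,k}$ denotes the measure of $A$ under the law with distribution function $G_{n,k}$. *)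

(* Defs.v *)
From HB Require Import structures.
From mathcomp Require Import all_boot all_order all_algebra.
From mathcomp Require Import all_classical all_reals all_analysis.
From mathcomp Require Import measurable_realfun.
Import Order.TTheory GRing.Theory Num.Theory.
Import numFieldNormedType.Exports.

Set Implicit Arguments.
Unset Strict Implicit.
Unset Printing Implicit Defensive.

Local Open Scope classical_set_scope.
Local Open Scope ring_scope.

(* The disjoint union of the spaces R^k, k >= 0, in which the offspring vectors
   (K_v, X_{v,1}, ..., X_{v,K_v}) take their values: K_v is the size of the
   sequence. Its sigma-algebra is that of the disjoint union, i.e., a set is
   measurable iff its trace on each R^k is a Borel set. *)
Definition ragged (R : realType) : Type := seq R.

HB.instance Definition _ (R : realType) := gen_eqMixin (ragged R).
HB.instance Definition _ (R : realType) := gen_choiceMixin (ragged R).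
HB.instance Definition _ (R : realType) := isPointed.Build (ragged R) [::].

Fact ragged_display : measure_display.
Proof. exact: default_measure_display. Qed.

Section ragged_measurable.
Variable R : realType.

Definition ragged_measurable (A : set (ragged R)) : Prop :=
  forall k, measurable [set x : k.-tuple R | A (tval x)].

Let measurable0 : ragged_measurable set0.
Proof. by move=> k; exact: measurable0. Qed.

Let measurableC A : ragged_measurable A -> ragged_measurable (~` A).
Proof. by move=> mA k; exact: measurableC (mA k). Qed.

Let measurable_bigcup (F : (set (ragged R))^nat) :
  (forall i, ragged_measurable (F i)) -> ragged_measurable (\bigcup_i F i).
Proof.
by move=> mF k; apply: (bigcupT_measurable (fun i => [set x : k.-tuple R | F i (tval x)])) => i;
  exact: mF.
Qed.

HB.instance Definition _ := @isMeasurable.Build ragged_display (ragged R)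
  ragged_measurable measurable0 measurableC measurable_bigcup.

End ragged_measurable.

Lemma measurable_ragged_size (R : realType) (B : set nat) :
  measurable [set x : ragged R | B (size x)].
Proof.
move=> k; have [Bk|nBk] := pselect (B k).
  rewrite [X in measurable X](_ : _ = setT) //.
  by apply/seteqP; split => // x _; rewrite /= size_tuple.
rewrite [X in measurable X](_ : _ = set0) //.
by apply/seteqP; split => // x; rewrite /= size_tuple.
Qed.

Lemma measurable_ragged_nth (R : realType) (i : nat) :
  measurable_fun setT (fun x : ragged R => nth 0 x i).
Proof.
move=> _ B mB; rewrite setTI.
change (ragged_measurable
  ((fun x : ragged R => nth 0 x i) @^-1` B)) => k.
have [ik|ki] := ltnP i k.
  rewrite [X in measurable X](_ : _ =
    (fun x : k.-tuple R => tnth x (Ordinal ik)) @^-1` B).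
    by rewrite -[X in measurable X]setTI; exact: measurable_tnth.
  by apply/seteqP; split => x; rewrite /= (tnth_nth 0).
have [B0|nB0] := pselect (B 0).
  rewrite [X in measurable X](_ : _ = setT) //.
  by apply/seteqP; split => // x _;
    rewrite /= nth_default ?size_tuple.
rewrite [X in measurable X](_ : _ = set0) //.
by apply/seteqP; split => // x;
  rewrite /= nth_default ?size_tuple.
Qed.

Definition mutually_independent d d' (T : measurableType d)
    (T' : measurableType d') (R : realType) (P : probability T R)
    (I : choiceType) (X : I -> {RV P >-> T'}) : Prop :=
  forall (s : seq I) (A : I -> set T'), uniq s ->
    (forall i, measurable (A i)) ->
    P (\bigcap_(i in [set` s]) X i @^-1` A i) =
    (\prod_(i <- s) P (X i @^-1` A i))%E.
Arguments mutually_independent {d d' T T' R} P {I} X.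

Definition joint_cdf (R : realType) (k : nat) (mu : probability (k.-tuple R) R)
    (x : 'I_k -> R) : \bar R :=
  mu [set y | forall i, tnth y i <= x i].

(* Ulam-Harris labels: the root is [::] and i :: v is the child of v with
   displacement X_{v,i+1}; thus size v is the generation of v. *)
Notation particle := (seq nat).

(* G n k is the law on R^k with distribution function G_{n,k}; p n 0 and G n 0
   are irrelevant. Offspring vectors are attached to all labels, including
   those of particles that are never born: since they are independent, the law
   imposed here on offspring v is also its conditional law given the positions
   in all generations up to that of v. *)
Record gbrw d (T : measurableType d) (R : realType) (P : probability T R)
    (p : nat -> nat -> R) (G : forall n k : nat, probability (k.-tuple R) R) :=
  GBRW {
  offspring :> particle -> {RV P >-> ragged R} ;
  offspring_gt0 : forall v w, (0 < size (offspring v w))%N ;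
  offspring_size : forall v k, (0 < k)%N ->
    P [set w | size (offspring v w) = k] = (p (size v) k)%:E ;
  offspring_displacement : forall v k (A : set (k.-tuple R)),
    (0 < k)%N -> measurable A ->
    P [set w | exists2 x : k.-tuple R, A x & offspring v w = tval x] =
    (P [set w | size (offspring v w) = k] * G (size v) k A)%E ;
  offspring_independent : mutually_independent P offspring }.

Section gbrw.
Context d (T : measurableType d) (R : realType) (P : probability T R).
Context (p : nat -> nat -> R) (G : forall n k : nat, probability (k.-tuple R) R).
Variable Z : gbrw P p G.

Fixpoint born (v : particle) (w : T) : bool :=
  if v is i :: u then born u w && (i < size (Z u w))%N else true.

Fixpoint position (v : particle) (w : T) : R :=
  if v is i :: u then position u w + nth 0 (Z u w) i else 0.

Definition alive (n : nat) (w : T) : set particle :=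
  [set v | size v = n /\ born v w].

(* A maximum, and a random variable: see max_positionP and
   measurable_max_position. *)
Definition max_position (n : nat) (w : T) : R :=
  sup [set position v w | v in alive n w].

Lemma alive_finite n w : finite_set (alive n w).
Proof.
elim: n => [|n IH].
  apply: (@sub_finite_set _ _ [set [::]]); last exact: finite_set1.
  by move=> [|i v] [].
apply: (@sub_finite_set _ _ (\bigcup_(u in alive n w)
    ((fun i => i :: u) @` `I_(size (Z u w))))).
  move=> [|i u] [//= [su]] /andP[bu iu].
  by exists u => //; exists i.
by apply: bigcup_finite => // u _; apply: finite_image; exact: finite_II.
Qed.

Lemma alive_neq0 n w : alive n w !=set0.
Proof.
exists (nseq n 0%N); split; first by rewrite size_nseq.
by elim: n => //= n ->; rewrite offspring_gt0.
Qed.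

Lemma max_positionP n w :
  (exists2 v, alive n w v & position v w = max_position n w) /\
  (forall v, alive n w v -> position v w <= max_position n w).
Proof.
have [s sE] := (finite_seqP (alive n w)).1 (alive_finite n w).
have [v vs vmax] : exists2 v, v \in s &
    forall u, u \in s -> position u w <= position v w.
  have [v0] := alive_neq0 n w; rewrite sE /=.
  elim: s {sE} v0 => // a [|b s] IH _ _.
    by exists a => [|u]; rewrite inE// => /eqP ->.
  have [v vs vmax] := IH b (mem_head _ _).
  have [av|va] := leP (position a w) (position v w).
    by exists v => [|u]; rewrite inE ?vs ?orbT// => /predU1P[->|/vmax].
  exists a => [|u]; rewrite inE ?eqxx// => /predU1P[->//|/vmax uv].
  exact: le_trans uv (ltW va).
have ub : ubound [set position v w | v in alive n w] (position v w).
  by move=> _ [u + <-]; rewrite sE => /vmax.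
have av : alive n w v by rewrite sE.
have max_v : max_position n w = position v w.
  apply/eqP; rewrite eq_le; apply/andP; split.
    by apply: ge_sup => //; exists (position v w), v.
  by apply: ub_le_sup; [exists (position v w)|exists v].
split; first by exists v.
by move=> u au; rewrite max_v; apply: ub; exists u.
Qed.

Lemma measurable_offspring_size v (B : set nat) :
  measurable [set w | B (size (Z v w))].
Proof.
have := @measurable_funPT _ _ _ _ (Z v) measurableT _ (measurable_ragged_size B).
by rewrite setTI.
Qed.

Lemma measurable_born v : measurable [set w | born v w].
Proof.
elim: v => [|i v IH] /=.
  by rewrite [X in measurable X](_ : _ = setT)//; apply/seteqP; split.
rewrite [X in measurable X](_ : _ =
    [set w | born v w] `&` [set w | (i < size (Z v w))%N]).
  by apply: measurableI => //; exact: (measurable_offspring_size v [set k | (i < k)%N]).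
by apply/seteqP; split => w /= => [/andP|[-> ->]].
Qed.

Lemma measurable_position v : measurable_fun setT (position v).
Proof.
elim: v => [|i v IH] /=; first exact: measurable_cst.
apply: measurable_funD => //.
exact: (measurableT_comp (@measurable_ragged_nth R i) (measurable_funPT (Z v))).
Qed.

Lemma measurable_max_position n : measurable_fun setT (max_position n).
Proof.
apply: (measurability (@RGenOInfty.G R)) => [|/= _ [_] [r] -> <-].
  exact: RGenOInfty.measurableE.
rewrite setTI [X in measurable X](_ : _ =
    \bigcup_(v in [set v | size v = n])
      ([set w | born v w] `&` position v @^-1` `]r, +oo[)).
  rewrite bigcup_mkcond; apply: countable_bigcupT_measurable => [|v];
    first exact: countableP.
  case: ifP => _ //; apply: measurableI (measurable_born v) _.
  rewrite -[X in measurable X]setTI.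
  by apply: measurable_position => //; exact: measurable_itv.
apply/seteqP; split => w /=; rewrite in_itv/= andbT.
  have [[v [sv bv] <-] _] := max_positionP n w => rv.
  by exists v => //; split => //=; rewrite in_itv/= andbT.
move=> [v sv [/= bv]]; rewrite in_itv/= andbT => /lt_le_trans; apply.
exact: (max_positionP n w).2.
Qed.

HB.instance Definition _ n :=
  @isMeasurableFun.Build _ _ _ _ (max_position n) (measurable_max_position n).

End gbrw.

Definition median d (T : measurableType d) (R : realType) (P : probability T R)
    (X : {RV P >-> R}) : R :=
  inf [set x | ((2^-1)%:E <= cdf X x)%E].
Arguments median {d T R} P X.

Definition recentred d (T : measurableType d) (R : realType)
    (P : probability T R) (X : {RV P >-> R}) : {RV P >-> R} :=
  (X : {mfun T >-> R}) - cst (median P X).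
Arguments recentred {d T R} P X.

Definition tight (I : Type) (R : realType) (mu : I -> probability R R) : Prop :=
  forall eps : R, 0 < eps ->
    exists2 K : set R, compact K & forall i, ((1 - eps)%:E <= mu i K)%E.

(* Main.v *)
(* Let u be the tail of the maximum, seen from one particle of some generation,
   and v the same one generation later. First-step decomposition gives
   u(x) = E[1 - prod_i (1 - v(x - X_i))].

   Right tail. For suitable eps, C, M, uniform in the generation, the inequality
     v(z - M) >= (1 + eps) v(z) - C v(z)^2 for all z
   passes from v to u, and it holds for the initial tail 1_{x < 0}. It makes v
   decay geometrically as soon as v <= eps / (2 C). Why it is preserved: the
   quadratic error is created at the level of v, but u is larger than the
   relevant values of v by a factor close to m0 > 1, so that a large C absorbs
   it. Displacements beyond M are harmless: let h(y) = v(x - y). Either h grows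
   slowly, and the exponential tail of the displacements beats the growth of
   h^2; or h makes a jump by a large factor over a distance L, and then the
   displacements beyond the jump contribute much more to u(x - M) than to u(x).

   Left tail. After boundedly many further generations there are many particles,
   each with its own chance of reaching the delta-quantile, while GT keeps the
   displacements bounded. Hence the maximum exceeds that quantile, minus a
   constant, with high probability. *)

Require Import Defs.
From HB Require Import structures.
From mathcomp Require Import all_boot all_order all_algebra.
From mathcomp Require Import all_classical all_reals all_analysis.
From mathcomp Require Import measurable_realfun.
From mathcomp Require Import ring lra.
Import Order.TTheory GRing.Theory Num.Theory.
Import numFieldNormedType.Exports.

Set Implicit Arguments.
Unset Strict Implicit.
Unset Printing Implicit Defensive.

Local Open Scope classical_set_scope.
Local Open Scope ring_scope.

(** The term [- C v^2] confines the claim to small values: where [C u(x) >= eps] it follows from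
    monotonicity, and near 1 no factor [1 + eps] could be gained. So if the claim fails at [x], then
    [C u(x) < eps], and [u(x - M) <= (1 + eps) u(x)] bounds [v] in turn: with [M = 3 L] and
    [L >= B], a child displaced by at least [-B] brings at least [h(2 L)] to [u(x - M)], whence
    [h(2 L) <= lam u(x)] for a fixed [lam < 1]. From there [h] is compared with the scale
    [J^i lam u(x)] at the grid points [(i + 2) L], and the brood is cut shortly before the first
    grid point where [h] exceeds the scale or the scale exceeds [1 / C]. Up to the cut, the
    inequality for [v] is used child by child. Beyond it no smallness is available and only a share
    [1 / (2 k0)] of the contributions is kept, which suffices after a jump by the factor [J = 8 k0].
    If it is the scale that ends the search, the children beyond the cut are so rare that dropping
    them is an error of order [u(x)^2]. *)

Lemma probability_setI_full d (T : measurableType d) (R : realType)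
    (P : probability T R) (A B : set T) : measurable A -> measurable B ->
  P B = 1%E -> P (A `&` B) = P A.
Proof.
move=> mA mB PB.
have -> : P A = (P (A `&` B) + P (A `&` ~` B))%E.
  rewrite -measureU//=; first by rewrite -setIUr setUv setIT.
  - exact: measurableI.
  - by apply: measurableI => //; exact: measurableC.
  - by rewrite setIACA setICr setI0.
rewrite [X in (_ + X)%E](_ : _ = 0%E) ?adde0//.
have mBC : measurable (~` B) by exact: measurableC.
have BC0 : P (~` B) = 0%E.
  have -> : P (~` B) = (1 - P B)%E by apply: probability_setC.
  by rewrite PB subee.
apply: (subset_measure0 (B := ~` B)) => //.
exact: measurableI.
Qed.

(** * Elementary inequalities for products over a brood *)

Section seq_inequalities.
Variable R : realType.
Implicit Types (s : seq R) (f b : R -> R).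

Lemma prod_itv01 s f : (forall y, 0 <= f y <= 1) ->
  0 <= \prod_(y <- s) f y <= 1.
Proof.
move=> f01; elim: s => [|y s IH]; first by rewrite big_nil ler01 lexx.
by rewrite big_cons; have := f01 y; nra.
Qed.

Lemma prod_onem_ge s b : (forall y, 0 <= b y <= 1) ->
  1 - \sum_(y <- s) b y <= \prod_(y <- s) (1 - b y).
Proof.
move=> b01; elim: s => [|y s IH]; first by rewrite !big_nil subr0.
rewrite !big_cons; have := b01 y.
have : 0 <= \prod_(y <- s) (1 - b y) <= 1.
  by apply: prod_itv01 => z; have := b01 z; lra.
nra.
Qed.

(** Second Bonferroni inequality, with the sum over pairs enlarged to the square of the whole
    sum. *)
Lemma prod_onem_le s b : (forall y, 0 <= b y <= 1) ->
  \prod_(y <- s) (1 - b y) <= 1 - \sum_(y <- s) b y + (\sum_(y <- s) b y) ^+ 2.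
Proof.
move=> b01; elim: s => [|y s IH]; first by rewrite !big_nil; lra.
rewrite !big_cons; have := b01 y.
have : 0 <= \prod_(y <- s) (1 - b y) <= 1.
  by apply: prod_itv01 => z; have := b01 z; lra.
have : 0 <= \sum_(y <- s) b y by apply: sumr_ge0 => z _; have := b01 z; lra.
nra.
Qed.

Lemma prod_onem_le1 s b y : (forall y, 0 <= b y <= 1) -> y \in s ->
  \prod_(y <- s) (1 - b y) <= 1 - b y.
Proof.
move=> b01 ys; rewrite (big_rem y)//=; have := b01 y.
have : 0 <= \prod_(y <- rem y s) (1 - b y) <= 1.
  by apply: prod_itv01 => z; have := b01 z; lra.
nra.
Qed.

Lemma sum_le_size s f c : (forall y, y \in s -> f y <= c) ->
  \sum_(y <- s) f y <= (size s)%:R * c.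
Proof.
elim: s => [|y s IH] fc; first by rewrite big_nil mul0r.
rewrite big_cons /= -[(size s).+1%:R]natr1 mulrDl mul1r addrC lerD//.
  by apply: IH => z zs; apply: fc; rewrite inE zs orbT.
by apply: fc; exact: mem_head.
Qed.

(** The product is at most each of its factors, hence at most their average. Unlike the Bonferroni
    bounds, this is informative even if [b] is not small. *)
Lemma prod_onem_le_avg s b (k : nat) : (forall y, 0 <= b y <= 1) ->
  (0 < k)%N -> (size s <= k)%N ->
  \prod_(y <- s) (1 - b y) <= 1 - k%:R^-1 * \sum_(y <- s) b y.
Proof.
move=> b01 k0 sk; set p := \prod_(_ <- _) _.
have p1 : 0 <= p <= 1.
  by apply: prod_itv01 => z; have := b01 z; lra.
have : \sum_(y <- s) b y <= (size s)%:R * (1 - p).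
  by apply: sum_le_size => y ys; have := prod_onem_le1 b01 ys; rewrite -/p; lra.
have kp : (0 : R) < k%:R by rewrite ltr0n.
have {}sk : (size s)%:R <= k%:R :> R by rewrite ler_nat.
move=> bp; have : k%:R^-1 * \sum_(y <- s) b y <= 1 - p; last lra.
rewrite mulrC ler_pdivrMr//; nra.
Qed.

Lemma sqr_sum_le s f :
  (\sum_(y <- s) f y) ^+ 2 <= (size s)%:R * \sum_(y <- s) f y ^+ 2.
Proof.
elim: s => [|y s IH]; first by rewrite !big_nil; lra.
rewrite !big_cons /= -[(size s).+1%:R]natr1.
have : 2 * f y * \sum_(z <- s) f z <= (size s)%:R * f y ^+ 2 + \sum_(z <- s) f z ^+ 2.
  elim: s {IH} => [|z s IH]; first by rewrite !big_nil/= mulr0 mul0r addr0.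
  rewrite !big_cons /= -[(size s).+1%:R]natr1.
  by have := sqr_ge0 (f y - f z); nra.
nra.
Qed.

(* The values below the cut count linearly, up to a quadratic error; above it,
   where b need not be small, only a fraction 1/k of the sum survives. *)
Lemma prod_onem_le_cut s b (k : nat) (c : R) : (forall y, 0 <= b y <= 1) ->
  (0 < k)%N -> (size s <= k)%N ->
  \prod_(y <- s) (1 - b y) <=
    1 - \sum_(y <- s) (if y <= c then b y else 0)
      + k%:R * \sum_(y <- s) (if y <= c then b y ^+ 2 else 0)
      - 2^-1 * k%:R^-1 * \sum_(y <- s) (if y <= c then 0 else b y).
Proof.
move=> b01 k0 sk.
pose bS y := if y <= c then b y else 0; pose bR y := if y <= c then 0 else b y.
have bS01 y : 0 <= bS y <= 1 by rewrite /bS; case: ifP => _; rewrite ?b01// lexx ler01.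
have bR01 y : 0 <= bR y <= 1 by rewrite /bR; case: ifP => _; rewrite ?b01// lexx ler01.
have -> : \prod_(y <- s) (1 - b y) =
    (\prod_(y <- s) (1 - bS y)) * \prod_(y <- s) (1 - bR y).
  rewrite -big_split/=; apply: eq_bigr => y _.
  by rewrite /bS /bR; case: ifP => _; lra.
have PS := prod_onem_le s bS01.
have PR := prod_onem_le_avg bR01 k0 sk.
have PS1 : 0 <= \prod_(y <- s) (1 - bS y) <= 1.
  by apply: prod_itv01 => z; have := bS01 z; lra.
have PR1 : 0 <= \prod_(y <- s) (1 - bR y) <= 1.
  by apply: prod_itv01 => z; have := bR01 z; lra.
have Q : (\sum_(y <- s) bS y) ^+ 2 <=
    k%:R * \sum_(y <- s) (if y <= c then b y ^+ 2 else 0).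
  apply: le_trans (sqr_sum_le _ _) _.
  have -> : \sum_(y <- s) (if y <= c then b y ^+ 2 else 0) = \sum_(y <- s) bS y ^+ 2.
    by apply: eq_bigr => y _; rewrite /bS; case: ifP => // _; rewrite expr0n.
  by rewrite ler_wpM2r ?ler_nat//; apply: sumr_ge0 => y _; exact: sqr_ge0.
rewrite -/(bS _) -/(bR _) in PS PR *.
set S := \sum_(y <- s) bS y in PS Q *.
set A := \sum_(y <- s) bR y in PR *.
have A0 : 0 <= k%:R^-1 * A.
  by rewrite mulr_ge0// sumr_ge0// => y _; have := bR01 y; lra.
rewrite -mulrA.
rewrite -/S.
set r := k%:R^-1 * A in PR A0 *.
set q := k%:R * _ in Q *.
set p1 := \prod_(y <- s) (1 - bS y) in PS PS1 *.
set p2 := \prod_(y <- s) (1 - bR y) in PR PR1 *.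
have H1 : p1 * p2 <= (1 - S + S ^+ 2) * (1 - r) by apply: ler_pM; lra.
(* Since [1 - S + S^2 >= 3/4] for every [S], at least half of [r] survives; this is the factor
   [2^-1] of the statement. *)
have H2 : r * 2^-1 <= r * (1 - S + S ^+ 2).
  by apply: ler_wpM2l => //; have := sqr_ge0 (S - 2^-1); nra.
have : (1 - S + S ^+ 2) * (1 - r) = (1 - S + S ^+ 2) - r * (1 - S + S ^+ 2) by ring.
have : 2^-1 * r = r * 2^-1 by ring.
change (\sum_(y <- s) (if y <= c then b y else 0)) with S.
lra.
Qed.

End seq_inequalities.

(** * Expectation and mean measure under an offspring law *)

Section expectation.
Context (R : realType) (k0 : nat).

Definition brood : set (ragged R) := [set xi | (0 < size xi <= k0)%N].

Lemma measurable_brood : measurable brood.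
Proof. exact: (measurable_ragged_size (fun k => (0 < k <= k0)%N)). Qed.

Lemma measurable_fun_ragged (f : ragged R -> R) :
  (forall k, measurable_fun setT (fun x : k.-tuple R => f (tval x))) ->
  measurable_fun setT f.
Proof.
move=> mf _ B mB; rewrite setTI.
change (ragged_measurable (f @^-1` B)) => k.
by have := mf k measurableT B mB; rewrite setTI.
Qed.

(** Bounded on broods only: sums over [xi] are unbounded on the whole of [ragged R]. *)
Definition observable (f : ragged R -> R) :=
  measurable_fun setT f /\ exists c, forall xi, brood xi -> `|f xi| <= c.

Definition bounded_meas (f : R -> R) :=
  measurable_fun setT f /\ exists c, forall y, `|f y| <= c.

Lemma observable_sum f : bounded_meas f ->
  observable (fun xi => \sum_(y <- xi) f y).
Proof.
move=> [mf [c fc]]; split.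
  apply: measurable_fun_ragged => k.
  under eq_fun do rewrite big_tuple.
  apply: measurable_sum => i.
  exact: (measurableT_comp mf (measurable_tnth i)).
exists (k0%:R * c) => xi /andP[_ xik].
apply: le_trans (ler_norm_sum _ _ _) _.
have c0 : 0 <= c by apply: le_trans (fc 0).
apply: le_trans (sum_le_size (c := c) _) _ => [y _|]; first exact: fc.
by rewrite ler_wpM2r// ler_nat.
Qed.

Lemma observable_prod (f : R -> R) : measurable_fun setT f -> (forall y, 0 <= f y <= 1) ->
  observable (fun xi => \prod_(y <- xi) f y).
Proof.
move=> mf f01; split.
  apply: measurable_fun_ragged => k.
  under eq_fun do rewrite big_tuple.
  apply: measurable_prod => i _.
  exact: (measurableT_comp mf (measurable_tnth i)).
exists 1 => xi _; have /andP[p0 p1] := prod_itv01 xi f01.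
by rewrite ger0_norm.
Qed.

Lemma observable_size (f : nat -> R) : observable (fun xi => f (size xi)).
Proof.
split.
  apply: measurable_fun_ragged => k.
  under eq_fun do rewrite size_tuple.
  exact: measurable_cst.
exists (\sum_(k < k0.+1) `|f k|) => xi /andP[_ xik].
rewrite -ltnS in xik.
by rewrite (bigD1 (Ordinal xik))//= lerDl sumr_ge0.
Qed.

Lemma observable_cst c : observable (fun=> c).
Proof. by split; [exact: measurable_cst|exists `|c|]. Qed.

Lemma observable_indic (A : set (ragged R)) : measurable A -> observable (\1_A).
Proof.
move=> mA; split; first exact: measurable_indic.
by exists 1 => xi _; rewrite indicE; case: (_ \in _); rewrite ?normr1 ?normr0.
Qed.

Lemma observableD (f g : ragged R -> R) : observable f -> observable g ->
  observable (fun xi => f xi + g xi).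
Proof.
move=> [mf [c fc]] [mg [c' gc]]; split; first exact: measurable_funD.
exists (c + c') => xi bxi.
by apply: le_trans (ler_normD _ _) _; rewrite lerD ?fc ?gc.
Qed.

Lemma observableZ a f : observable f -> observable (fun xi => a * f xi).
Proof.
move=> [mf [c fc]]; split; first exact: measurable_funM.
by exists (`|a| * c) => xi bxi; rewrite normrM ler_wpM2l ?fc.
Qed.

Lemma observable_bigsum (I : Type) (s : seq I) (F : I -> ragged R -> R) :
  (forall i, observable (F i)) -> observable (fun xi => \sum_(i <- s) F i xi).
Proof.
move=> oF; elim: s => [|i s IH].
  by under eq_fun do rewrite big_nil; exact: observable_cst.
by under eq_fun do rewrite big_cons; exact: observableD.
Qed.

Variable mu : probability (ragged R) R.
Hypothesis mu_brood : mu brood = 1%E.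

(** The restriction to broods loses nothing when [mu brood = 1], and it makes every [observable]
    integrable. *)
Definition expect (f : ragged R -> R) := \int[mu]_(xi in brood) f xi.

Lemma observable_integrable f : observable f ->
  mu.-integrable brood (EFin \o f).
Proof.
move=> [mf [c fc]]; apply: measurable_bounded_integrable.
- exact: measurable_brood.
- by apply: le_lt_trans (ltry 1); rewrite -mu_brood.
- exact: measurable_funTS.
- exists c; split; first exact: num_real.
  by move=> e ce xi bxi; apply: le_trans (ltW ce); exact: fc.
Qed.

Lemma expectD f g : observable f -> observable g ->
  expect (fun xi => f xi + g xi) = expect f + expect g.
Proof.
by move=> of_ og; apply: RintegralD; [exact: measurable_brood|exact: observable_integrable..].
Qed.

Lemma expectZ a f : observable f -> expect (fun xi => a * f xi) = a * expect f.
Proof.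
by move=> of_; apply: RintegralZl; [exact: measurable_brood|exact: observable_integrable].
Qed.

Lemma le_expect f g : observable f -> observable g ->
  (forall xi, brood xi -> f xi <= g xi) -> expect f <= expect g.
Proof.
by move=> of_ og fg; apply: le_Rintegral; [exact: measurable_brood|exact: observable_integrable..|].
Qed.

Lemma expect_cst c : expect (fun=> c) = c.
Proof.
rewrite /expect Rintegral_cst; last exact: measurable_brood.
have -> : fine (mu brood) = 1 by rewrite mu_brood.
by rewrite mulr1.
Qed.

Lemma expect_indic (A : set (ragged R)) : measurable A -> (expect (\1_A))%:E = mu A.
Proof.
move=> mA; rewrite /expect /Rintegral integral_indic//; last exact: measurable_brood.
rewrite fineK; last by rewrite fin_num_measure//; exact: measurableI measurable_brood.
exact: probability_setI_full measurable_brood mu_brood.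
Qed.

Lemma expect_bigsum (I : Type) (s : seq I) (F : I -> ragged R -> R) :
  (forall i, observable (F i)) ->
  expect (fun xi => \sum_(i <- s) F i xi) = \sum_(i <- s) expect (F i).
Proof.
move=> oF; elim: s => [|i s IH].
  by rewrite big_nil; under eq_fun do rewrite big_nil; rewrite expect_cst.
rewrite big_cons -IH -expectD//; last exact: observable_bigsum.
by congr expect; apply/funext => xi; rewrite big_cons.
Qed.

(** Integral against the mean measure of the offspring point process. Being linear in the children,
    it involves only the marginals of the displacements. *)
Definition intensity (f : R -> R) := expect (fun xi => \sum_(y <- xi) f y).

Lemma intensityD f g : bounded_meas f -> bounded_meas g ->
  intensity (fun y => f y + g y) = intensity f + intensity g.
Proof.
move=> bf bg; rewrite /intensity -expectD//; [|exact: observable_sum..].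
by congr expect; apply/funext => xi; rewrite big_split.
Qed.

Lemma intensityZ a f : bounded_meas f ->
  intensity (fun y => a * f y) = a * intensity f.
Proof.
move=> bf; rewrite /intensity -expectZ//; last exact: observable_sum.
by congr expect; apply/funext => xi; rewrite big_distrr.
Qed.

Lemma le_intensity f g : bounded_meas f -> bounded_meas g ->
  (forall y, f y <= g y) -> intensity f <= intensity g.
Proof.
move=> bf bg fg; apply: le_expect; [exact: observable_sum..|] => xi _.
exact: ler_sum.
Qed.

Lemma intensity_ge0 f : (forall y, 0 <= f y) -> 0 <= intensity f.
Proof. by move=> f0; apply: Rintegral_ge0 => xi _; apply: sumr_ge0. Qed.

Lemma intensity_cst c : intensity (fun=> c) = c * expect (fun xi => (size xi)%:R).
Proof.
rewrite /intensity -expectZ; last exact: (observable_size (fun k => k%:R)).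
by congr expect; apply/funext => xi; rewrite big_const_seq count_predT iter_addr_0 mulr_natr.
Qed.

Lemma expect_size_le : expect (fun xi => (size xi)%:R) <= k0%:R.
Proof.
rewrite -[leRHS]expect_cst; apply: le_expect => [||xi /andP[_]].
- exact: (observable_size (fun k => k%:R)).
- exact: observable_cst.
- by rewrite ler_nat.
Qed.

End expectation.

(** * Offspring laws and their tails *)

Section bounded_meas_theory.
Variable R : realType.
Implicit Types f g : R -> R.

Lemma bounded_meas_nd f (c : R) : {homo f : y z / y <= z} ->
  (forall y, `|f y| <= c) -> bounded_meas f.
Proof.
move=> fnd fc; split; last by exists c.
by apply: nondecreasing_measurable => // y z; exact: fnd.
Qed.

Lemma bounded_meas_cst c : bounded_meas (fun=> c : R).
Proof. by split; [exact: measurable_cst|exists `|c|]. Qed.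

Lemma bounded_measD f g : bounded_meas f -> bounded_meas g ->
  bounded_meas (fun y => f y + g y).
Proof.
move=> [mf [c fc]] [mg [c' gc]]; split; first exact: measurable_funD.
exists (c + c') => y.
by apply: le_trans (ler_normD _ _) _; rewrite lerD ?fc ?gc.
Qed.

Lemma bounded_measM f g : bounded_meas f -> bounded_meas g ->
  bounded_meas (fun y => f y * g y).
Proof.
move=> [mf [c fc]] [mg [c' gc]]; split; first exact: measurable_funM.
exists (c * c') => y; rewrite normrM ler_pM//.
Qed.

Lemma bounded_measZ c f : bounded_meas f -> bounded_meas (fun y => c * f y).
Proof. by apply: bounded_measM; exact: bounded_meas_cst. Qed.

Lemma bounded_meas_if (b : R -> bool) f g : measurable_fun setT b ->
  bounded_meas f -> bounded_meas g ->
  bounded_meas (fun y => if b y then f y else g y).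
Proof.
move=> mb [mf [c fc]] [mg [c' gc]]; split; first exact: measurable_fun_ifT.
exists (Num.max c c') => y.
by case: ifP => _; rewrite le_max ?fc ?gc ?orbT.
Qed.

Lemma bounded_meas_sum (I : Type) (s : seq I) (F : I -> R -> R) :
  (forall i, bounded_meas (F i)) -> bounded_meas (fun y => \sum_(i <- s) F i y).
Proof.
move=> bF; elim: s => [|i s IH].
  by under eq_fun do rewrite big_nil; exact: bounded_meas_cst.
by under eq_fun do rewrite big_cons; exact: bounded_measD.
Qed.

Lemma measurable_ler (c : R) : measurable_fun setT (fun y : R => y <= c).
Proof. by apply: measurable_fun_ler => //; exact: measurable_cst. Qed.

Lemma bounded_meas_tail (c : R) : bounded_meas (fun y : R => (c < y)%R%:R : R).
Proof.
apply: (bounded_meas_nd (c := 1)) => [y z yz|y]; last by rewrite ger0_norm ?ler0n// lern1 leq_b1.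
by rewrite ler_nat; case: ltP => // /lt_le_trans->.
Qed.

End bounded_meas_theory.

(** * Discrete layer-cake decomposition *)

Section layers.
Variable R : realType.

Lemma count_lt_bounds (s : R) (N : nat) : 0 <= s ->
  [/\ Num.min s N%:R <= \sum_(l < N) (l%:R < s)%R%:R,
      \sum_(l < N) (l%:R < s)%R%:R <= s + 1 &
      \sum_(l < N) (l%:R < s)%R%:R <= N%:R :> R].
Proof.
move=> s0; elim: N => [|N [IH1 IH2 IH3]].
  by rewrite big_ord0 ge_min lexx orbT; split => //; rewrite addr_ge0.
rewrite big_ord_recr/= -[N.+1%:R]natr1.
have [Ns|sN] := ltP N%:R s; rewrite /= ?addr0 ?mulr1n.
  rewrite (min_idPr (ltW Ns)) in IH1.
  by split; [rewrite ge_min; apply/orP; right|..]; lra.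
by split; [rewrite ge_min; move: IH1; rewrite (min_idPl sN) => IH1; apply/orP; left|..]; lra.
Qed.

(** The sum is [h] rounded up to a multiple of [1 / N.+1]. *)
Lemma layer_bounds (h : R) (N : nat) : 0 <= h <= 1 ->
  h <= \sum_(l < N.+1) N.+1%:R^-1 * (l%:R / N.+1%:R < h)%R%:R <= h + N.+1%:R^-1.
Proof.
move=> /andP[h0 h1].
have n0 : 0 < N.+1%:R :> R by rewrite ltr0n.
have -> : \sum_(l < N.+1) N.+1%:R^-1 * (l%:R / N.+1%:R < h)%R%:R =
    (\sum_(l < N.+1) (l%:R < h * N.+1%:R)%R%:R) / N.+1%:R :> R.
  rewrite [RHS]mulrC big_distrr/=; apply: eq_bigr => l _.
  by rewrite ltr_pdivrMr.
have [c1 c2 _] := @count_lt_bounds (h * N.+1%:R) N.+1 (mulr_ge0 h0 (ltW n0)).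
rewrite ler_pdivlMr// ler_pdivrMr// mulrDl mulVf ?gt_eqF// c2 andbT.
by apply: le_trans c1; rewrite le_min lexx ler_piMl// ltW.
Qed.

End layers.

Section offspring_law.
Context (R : realType) (k0 : nat) (m0 a M0 : R).

(** [law_tail] is (MT2) summed over the children, a form in which the dependence between siblings no
    longer appears. *)
Record regular_law (mu : probability (ragged R) R) : Prop := RegularLaw {
  law_brood : mu (brood k0) = 1%E ;
  law_mean : m0 <= expect k0 mu (fun xi => (size xi)%:R) ;
  law_tail : forall M z, M0 < M -> 0 <= z ->
    intensity k0 mu (fun y => (z + M < y)%R%:R) <=
      expR (- (a * M)) * intensity k0 mu (fun y => (z < y)%R%:R) }.

Variable mu : probability (ragged R) R.
Hypothesis mu_reg : regular_law mu.
Let mub := law_brood mu_reg.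
Local Notation intensity := (intensity k0 mu).

Lemma intensity_sum (I : Type) (s : seq I) (F : I -> R -> R) :
  (forall i, bounded_meas (F i)) ->
  intensity (fun y => \sum_(i <- s) F i y) = \sum_(i <- s) intensity (F i).
Proof.
move=> bF; elim: s => [|i s IH].
  rewrite big_nil; under eq_fun do rewrite big_nil.
  by rewrite intensity_cst// mul0r.
rewrite big_cons -IH -intensityD//; last exact: bounded_meas_sum.
by congr intensity; apply/funext => y; rewrite big_cons.
Qed.

Lemma intensity_le f c : bounded_meas f -> 0 <= c -> (forall y, f y <= c) ->
  intensity f <= c * k0%:R.
Proof.
move=> bf c0 fc; apply: le_trans (le_intensity mub bf (bounded_meas_cst c) fc) _.
by rewrite intensity_cst// ler_wpM2l// expect_size_le.
Qed.


(** The up-set [V] is a half-line starting at its infimum [t], open or closed, whereas [law_tail]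
    compares open half-lines. Half of the shift [L] is given up to pass from a possibly closed
    half-line at [t + L] to the open one at [t + L / 2]. *)
Lemma intensity_shift (V : R -> bool) (z L : R) : 0 <= z -> M0 < L / 2 -> 0 < L ->
  (forall y, V y -> z < y) -> (forall y y', y <= y' -> V y -> V y') ->
  intensity (fun y => (V (y - L))%:R) <=
    expR (- (a * (L / 2))) * intensity (fun y => (V y)%:R).
Proof.
move=> z0 ML L0 Vz Vup.
have bV c : bounded_meas (fun y => (V (y - c))%:R : R).
  apply: (bounded_meas_nd (c := 1)) => [y y' yy|y]; last by rewrite ger0_norm ?ler0n// lern1 leq_b1.
  by rewrite ler_nat; case: (boolP (V (y - c))) => // /(Vup _ _ (lerB yy (lexx c)))->.
have bV0 : bounded_meas (fun y => (V y)%:R : R).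
  by have := bV 0; under eq_fun do rewrite subr0.
have [[y0 Vy0]|nV] := pselect (exists y, V y); last first.
  have V0 y : V y = false by apply/negP => Vy; apply: nV; exists y.
  under eq_fun do rewrite V0.
  rewrite intensity_cst// mul0r mulr_ge0 ?expR_ge0// intensity_ge0//.
pose t := inf [set y | V y].
have hV : has_inf [set y | V y] by split; [exists y0|exists z => y /Vz/ltW].
have tz : z <= t by apply: lb_le_inf; [exists y0|move=> y /Vz/ltW].
have Vt y : V y -> t <= y by move=> Vy; apply: ge_inf => //; exact: hV.2.
have tV y : t < y -> V y.
  move=> ty; have yt0 : 0 < y - t by lra.
  have [y' Vy' y'y] := inf_adherent yt0 hV.
  by apply: Vup Vy'; rewrite -/t in y'y; lra.
apply: (@le_trans _ _ (intensity (fun y => (t + L / 2 < y)%R%:R))).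
  apply: le_intensity => // [|y]; first exact: bounded_meas_tail.
  rewrite ler_nat; case: (boolP (V _)) => // /Vt ty.
  by rewrite (_ : t + L / 2 < y)//; lra.
apply: (le_trans (law_tail mu_reg ML _)); first lra.
rewrite ler_wpM2l ?expR_ge0// le_intensity// => [|y]; first exact: bounded_meas_tail.
by rewrite ler_nat; case: ltP => // /tV->.
Qed.

(** Beyond [z] the superlevel sets of [h (y + L)] are up-sets, to which the shift bound applies, and
    [h] is a mixture of their indicators. With [N.+1] levels the discretization error is [O(1 / N)],
    and [N] is arbitrary. *)
Lemma intensity_shift_nd (h : R -> R) (z L : R) :
  0 <= z -> M0 < L / 2 -> 0 < L ->
  {homo h : y y' / y <= y'} -> (forall y, 0 <= h y <= 1) ->
  intensity (fun y => if y <= z + L then 0 else h y) <=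
    expR (- (a * (L / 2))) * intensity (fun y => if y <= z then 0 else h (y + L)).
Proof.
move=> z0 ML L0 hnd h01.
have bh c : bounded_meas (fun y => h (y + c)).
  apply: (bounded_meas_nd (c := 1)) => [y y' yy|y]; first by apply: hnd; lra.
  by have /andP[? ?] := h01 (y + c); rewrite ger0_norm.
have bif c d : bounded_meas (fun y => if y <= c then 0 else h (y + d)).
  by apply: bounded_meas_if; [exact: measurable_ler|exact: bounded_meas_cst|].
have bif0 c : bounded_meas (fun y => if y <= c then 0 else h y).
  by have := bif c 0; under eq_fun do rewrite addr0.
set q := expR _.
have q0 : 0 <= q by exact: expR_ge0.
set X := intensity _; set Y := intensity _.
suff HN (N : nat) : X <= q * Y + q * k0%:R / N.+1%:R.
  apply/ler_addgt0Pr => e e0.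
  have [qk0|k00] := eqVneq (q * k0%:R) 0.
    by apply: le_trans (HN 0%N) _; rewrite qk0 mul0r lerD2l ltW.
  have qk : 0 < q * k0%:R by rewrite lt_neqAle eq_sym k00 mulr_ge0.
  pose N := Num.Def.archi_bound (q * k0%:R / e).
  apply: le_trans (HN N) _; rewrite lerD2l.
  rewrite ler_pdivrMr ?ltr0n// [leRHS]mulrC -ler_pdivrMr//.
  apply/ltW/(lt_le_trans (archi_boundP (divr_ge0 (ltW qk) (ltW e0)))).
  by rewrite ler_nat.
pose V (l : 'I_N.+1) (y : R) := (z < y) && (l%:R / N.+1%:R < h (y + L)).
have Vz l y : V l y -> z < y by case/andP.
have Vup l y y' : y <= y' -> V l y -> V l y'.
  move=> yy' /andP[zy hy]; rewrite /V (lt_le_trans zy)//=.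
  by apply: lt_le_trans hy _; apply: hnd; lra.
have bV l c : bounded_meas (fun y => (V l (y - c))%:R : R).
  apply: (bounded_meas_nd (c := 1)) => [y y' yy|y]; last by rewrite ger0_norm ?ler0n// lern1 leq_b1.
  by rewrite ler_nat; case: (boolP (V l (y - c))) => // /(Vup l _ _ (lerB yy (lexx c)))->.
have bV0 l : bounded_meas (fun y => (V l y)%:R : R).
  by have := bV l 0; under eq_fun do rewrite subr0.
have n0 : 0 <= N.+1%:R^-1 :> R by rewrite invr_ge0.
apply: (@le_trans _ _ (intensity (fun y => \sum_(l < N.+1) N.+1%:R^-1 * (V l (y - L))%:R))).
  apply: le_intensity => // [|y].
    by apply: bounded_meas_sum => l; exact: bounded_measZ.
  case: ifPn => [_|]; first by apply: sumr_ge0 => l _; rewrite mulr_ge0.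
  rewrite -ltNge => zy; have /andP[+ _] := layer_bounds N (h01 y).
  move/le_trans; apply; apply: ler_sum => l _.
  by rewrite /V subrK (_ : z < y - L)//; lra.
rewrite intensity_sum; last by move=> l; exact: bounded_measZ.
apply: (@le_trans _ _ (q * intensity (fun y => \sum_(l < N.+1) N.+1%:R^-1 * (V l y)%:R))).
  rewrite intensity_sum; last by move=> l; exact: bounded_measZ.
  rewrite big_distrr/=; apply: ler_sum => l _.
  rewrite !intensityZ// mulrCA ler_wpM2l//.
  by apply: (intensity_shift z0 ML L0); [exact: Vz|exact: Vup].
rewrite -mulrA -mulrDr ler_wpM2l//.
apply: (@le_trans _ _ (intensity (fun y => (if y <= z then 0 else h (y + L)) + N.+1%:R^-1))).
  apply: le_intensity => // [||y].
  - by apply: bounded_meas_sum => l; exact: bounded_measZ.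
  - by apply: bounded_measD => //; exact: bounded_meas_cst.
  case: ifPn => [yz|].
    rewrite big1 ?add0r// => l _.
    by rewrite /V ltNge yz/= mulr0.
  rewrite -ltNge => zy; have /andP[_ +] := layer_bounds N (h01 (y + L)).
  by apply: le_trans; apply: ler_sum => l _; rewrite /V zy.
rewrite intensityD//; last exact: bounded_meas_cst.
rewrite lerD2l mulrC; apply: intensity_le => //; exact: bounded_meas_cst.
Qed.

End offspring_law.

(** * Steepness of the right tail *)

Section branching_operator.
Context (R : realType) (k0 : nat) (mu : probability (ragged R) R).
Implicit Types v : R -> R.

Definition tail_function v :=
  {homo v : x y / x <= y >-> y <= x} /\ (forall x, 0 <= v x <= 1).

(* If v is the tail of the maximum over each subtree, this is the tail of the
   maximum over the whole tree. *)
Definition branch v (x : R) : R :=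
  1 - expect k0 mu (fun xi => \prod_(y <- xi) (1 - v (x - y))).

Hypothesis mub : mu (brood k0) = 1%E.

Lemma observable_branch (b : R -> R) : measurable_fun setT b ->
  (forall y, 0 <= b y <= 1) ->
  observable k0 (fun xi => \prod_(y <- xi) (1 - b y)).
Proof.
move=> mb b01; apply: observable_prod => [|y]; last by have := b01 y; lra.
by apply: measurable_funB => //; exact: measurable_cst.
Qed.

Lemma measurable_tail v (c : R) : tail_function v -> measurable_fun setT (fun y : R => v (c - y)).
Proof.
move=> [vni _]; apply: nondecreasing_measurable => // y z yz.
by apply: vni; lra.
Qed.

Lemma bounded_meas_shift v (c : R) : tail_function v -> bounded_meas (fun y : R => v (c - y)).
Proof.
move=> vt; split; first exact: measurable_tail.
by exists 1 => y; have /andP[v0 v1] := vt.2 (c - y); rewrite ger0_norm.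
Qed.

Lemma observable_branch_tail v (x : R) : tail_function v ->
  observable k0 (fun xi => \prod_(y <- xi) (1 - v (x - y))).
Proof.
by move=> vt; apply: observable_branch => [|y]; [exact: measurable_tail|exact: vt.2].
Qed.

Lemma tail_branch v : tail_function v -> tail_function (branch v).
Proof.
move=> vt; split=> [x y xy|x].
  rewrite /branch lerB//; apply: le_expect => // [||xi _].
  - exact: observable_branch_tail.
  - exact: observable_branch_tail.
  elim: xi => [|z xi IH]; first by rewrite !big_nil.
  rewrite !big_cons ler_pM//.
  - by have := vt.2 (x - z); lra.
  - suff /andP[] : 0 <= \prod_(y <- xi) (1 - v (x - y)) <= 1 by [].
    by apply: prod_itv01 => y'; have := vt.2 (x - y'); lra.
  - by rewrite lerB// vt.1// lerB.
have p01 xi : 0 <= \prod_(y <- xi) (1 - v (x - y)) <= 1.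
  by apply: prod_itv01 => z; have := vt.2 (x - z); lra.
have p0 : 0 <= expect k0 mu (fun xi => \prod_(y <- xi) (1 - v (x - y))).
  by apply: Rintegral_ge0 => xi _; have /andP[] := p01 xi.
have p1 : expect k0 mu (fun xi => \prod_(y <- xi) (1 - v (x - y))) <= 1.
  rewrite -[leRHS](expect_cst mub); apply: le_expect => //.
  - exact: observable_branch_tail.
  - exact: observable_cst.
  - by move=> xi _; have /andP[] := p01 xi.
by rewrite /branch; lra.
Qed.

Lemma branch_le_intensity v (x : R) : tail_function v ->
  branch v x <= intensity k0 mu (fun y => v (x - y)).
Proof.
move=> vt; have bv := bounded_meas_shift x vt.
rewrite /branch lerBlDr -[leLHS](expect_cst mub) /intensity -expectD//.
- apply: le_expect => // [||xi _].
  + exact: observable_cst.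
  + apply: observableD; first exact: observable_sum.
    exact: observable_branch_tail.
  + have := @prod_onem_ge _ xi (fun y => v (x - y)) (fun y => vt.2 (x - y)).
    by lra.
- exact: observable_sum.
- exact: observable_branch_tail.
Qed.

Lemma branch_ge v (x : R) (f : ragged R -> R) : tail_function v -> observable k0 f ->
  (forall xi, brood k0 xi -> f xi <= 1 - \prod_(y <- xi) (1 - v (x - y))) ->
  expect k0 mu f <= branch v x.
Proof.
move=> vt of_ fb.
suff : expect k0 mu f + expect k0 mu (fun xi => \prod_(y <- xi) (1 - v (x - y))) <= 1.
  by rewrite /branch; lra.
rewrite -expectD//; last exact: observable_branch_tail.
rewrite -[leRHS](expect_cst mub); apply: le_expect => //.
- by apply: observableD => //; exact: observable_branch_tail.
- exact: observable_cst.
- by move=> xi /fb; lra.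
Qed.

End branching_operator.

(* U and U' are the tail of the maximum at x and x - M, A is the expected sum
   of v over the offspring, and N2 the same for v^2 without the far offspring. *)
Lemma absorb_error (R : realFieldType) (K C lam eps U A N2 q r U' : R) :
  1 <= K -> 8 * K <= C -> 8 * K <= (1 - lam) * C -> 0 < eps -> eps <= 4^-1 ->
  0 < lam -> lam < 1 -> 0 < U -> C * U < eps -> U <= A ->
  0 <= q -> q <= r -> r * (C + C ^+ 2) <= 1 ->
  N2 <= lam * U * A + K * q * (lam * U) ^+ 2 ->
  (1 + eps) * A - (C + 4 * K) * N2 - 2 * (K * C ^+ 2 * r * (lam * U) ^+ 2) <= U' ->
  (1 + eps) * U - C * U ^+ 2 <= U'.
Proof.
move=> K1 CK CKlam eps0 eps1 lam0 lam1 U0 CU UA q0 qr rC.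
set t := lam * U => N2_le low.
have t0 : 0 < t by rewrite mulr_gt0.
have tU : t <= U by rewrite ler_piMl// ltW.
have C0 : 0 < C by lra.
have C4 : 0 <= C + 4 * K by lra.
have low2 : (C + 4 * K) * N2 <= (C + 4 * K) * (t * A + K * q * t ^+ 2) by rewrite ler_wpM2l.
have coefA : (C + 4 * K) * t <= 1 + eps.
  have : (C + 4 * K) * t <= 2 * C * t by rewrite ler_wpM2r//; lra.
  have : C * t <= C * U by rewrite ler_pM2l.
  by lra.
have lowA : ((1 + eps) - (C + 4 * K) * t) * U <= ((1 + eps) - (C + 4 * K) * t) * A.
  by rewrite ler_wpM2l//; lra.
have t2 : t ^+ 2 <= U ^+ 2 by rewrite ler_sqr ?nnegrE// ltW.
(* The hypothesis [r (C + C^2) <= 1] keeps the total of all terms carrying [q] or [r] below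
   [2 K U^2]. *)
have tail1 : (C + 4 * K) * (K * q * t ^+ 2) + 2 * (K * C ^+ 2 * r * t ^+ 2) <= 2 * K * U ^+ 2.
  have kt0 : 0 <= K * t ^+ 2 by rewrite mulr_ge0 ?sqr_ge0//; lra.
  have T1 : (C + 4 * K) * q * (K * t ^+ 2) <= 2 * C * r * (K * t ^+ 2).
    by rewrite ler_wpM2r// ler_pM//; lra.
  have T2 : 2 * (r * (C + C ^+ 2)) * (K * t ^+ 2) <= 2 * 1 * (K * t ^+ 2).
    by rewrite ler_wpM2r// ler_pM2l.
  have T3 : K * t ^+ 2 <= K * U ^+ 2 by rewrite ler_wpM2l//; lra.
  by lra.
have U2 : 0 <= U ^+ 2 by exact: sqr_ge0.
(* Here [lam < 1] pays: [(C + 4 K) lam <= C - 4 K], so the main quadratic term leaves [4 K U^2] to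
   cover the remaining errors. *)
have k8 : (C + 4 * K) * t * U <= C * U ^+ 2 - 4 * K * U ^+ 2.
  have -> : (C + 4 * K) * t * U = ((C + 4 * K) * lam) * U ^+ 2 by rewrite /t; ring.
  rewrite -mulrBl ler_wpM2r//.
  have : 4 * K * lam <= 4 * K * 1 by rewrite ler_wpM2l//; lra.
  by lra.
have kU2 : 0 <= K * U ^+ 2 by rewrite mulr_ge0//; lra.
by lra.
Qed.

Section steepness.
Context (R : realType) (k0 : nat) (m0 a M0 : R).
Context (mu : probability (ragged R) R).
Hypothesis mu_reg : regular_law k0 m0 a M0 mu.
Hypothesis k0_gt0 : (0 < k0)%N.
Hypothesis a_gt0 : 0 < a.

Definition low_brood (B : R) : ragged R -> R :=
  fun xi => (all (fun y => - B <= y) xi)%:R.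
Definition high_brood (B : R) : ragged R -> R :=
  fun xi => (all (fun y => y <= B) xi)%:R.

Lemma observable_all (b : R -> bool) : measurable_fun setT b ->
  observable k0 (fun xi => (all b xi)%:R).
Proof.
move=> mb; have -> : (fun xi => (all b xi)%:R) =
    (fun xi : ragged R => \prod_(y <- xi) (if b y then 1 else 0 : R)).
  apply/funext => xi; elim: xi => [|y xi IH]; first by rewrite big_nil.
  by rewrite big_cons/= -IH; case: (b y); rewrite ?mul1r ?mul0r.
apply: observable_prod => [|y]; last by case: ifP; rewrite ?lexx ?ler01.
by apply: measurable_fun_ifT => //; exact: measurable_cst.
Qed.

Lemma observable_low B : observable k0 (low_brood B).
Proof.
by apply: observable_all; apply: measurable_fun_ler => //; exact: measurable_cst.
Qed.

Lemma observable_high B : observable k0 (high_brood B).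
Proof. by apply: observable_all; exact: measurable_ler. Qed.

Definition steep (eps C M : R) (v : R -> R) :=
  forall z, (1 + eps) * v z - C * v z ^+ 2 <= v (z - M).

(** [eta] bounds the probability that some child falls below [-B], [lam] is the contraction drawn
    from [m0 > 1], and [L] is the grid step, one third of the shift. *)
Variables (eta B lam eps C L : R).
Hypothesis low_mu : 1 - eta <= expect k0 mu (low_brood B).
Hypothesis m0_gt1 : 1 < m0.
Hypothesis eta_le : eta <= 2^-1.
Hypothesis eps_gt0 : 0 < eps.
Hypothesis eps_le : eps <= 4^-1.
Hypothesis lam_gt0 : 0 < lam.
Hypothesis lam_lt1 : lam < 1.
Hypothesis lamE : 1 + eps <= lam * ((1 - eta) * m0 - k0%:R * eta).
Hypothesis C_eta : 4 * eps * k0%:R <= eta * C.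
Hypothesis C_lam : 8 * k0%:R <= (1 - lam) * C.
Hypothesis L_B : B <= L.
Hypothesis L_gt0 : 0 < L.
Hypothesis L_M0 : M0 < L / 2.
Let q := expR (- (a * (L / 2))).
(** The growth over one grid step that counts as a jump. In the jump case the far sum consists of
    two parts of relative size at most [1 / J], and [2 / J = 1 / (4 k0)]. *)
Let J : R := 8 * k0%:R.
Hypothesis L_q : J ^+ 2 * q * (C + C ^+ 2) <= 1.

Let mub := law_brood mu_reg.
Let K1 : 1 <= k0%:R :> R. Proof. by rewrite ler1n. Qed.
Let C_ge8 : 8 * k0%:R <= C. Proof.
have l1 : 0 < 1 - lam by have := lam_lt1; lra.
have C0 : 0 <= C by rewrite -(pmulr_rge0 _ l1); have := C_lam; have := K1; lra.
by have := mulr_ge0 (ltW lam_gt0) C0; have := C_lam; lra.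
Qed.
Let q_gt0 : 0 < q. Proof. exact: expR_gt0. Qed.

Let r_le : J ^+ 2 * q <= 2^-1.
Proof.
have J2 : 0 <= J ^+ 2 by exact: sqr_ge0.
have := L_q; set r := J ^+ 2 * q; have r0 : 0 <= r by rewrite /r mulr_ge0// ltW.
by have := C_ge8; have := K1; nra.
Qed.

Section at_point.
Variables (v : R -> R) (x : R).
Hypothesis vt : tail_function v.
Hypothesis vs : steep eps C (3 * L) v.
Let h y := v (x - y).
Let U := branch k0 mu v x.
Let U' := branch k0 mu v (x - 3 * L).

Let h01 y : 0 <= h y <= 1. Proof. exact: vt.2. Qed.
Let hnd y z : y <= z -> h y <= h z. Proof. by move=> yz; apply: vt.1; lra. Qed.
Let hM y : v (x - 3 * L - y) = h (y + 3 * L).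
Proof. by rewrite /h; congr v; ring. Qed.

Let pM01 xi : 0 <= \prod_(y <- xi) (1 - h (y + 3 * L)) <= 1.
Proof. by apply: prod_itv01 => z; have := h01 (z + 3 * L); lra. Qed.

Let low_h y : - B <= y -> h (2 * L) <= h (y + 3 * L).
Proof. by move=> By; apply: hnd; have := L_B; lra. Qed.

(** One child is enough: if it is displaced by at least [-B >= -L], the shift by [3 L] leaves it at
    [2 L] or more. *)
Lemma quantile_crude : (1 - eta) * h (2 * L) <= U'.
Proof.
have th := h01 (2 * L).
apply: (@le_trans _ _ (expect k0 mu (fun xi => h (2 * L) * low_brood B xi))).
  rewrite expectZ//; last exact: observable_low.
  by rewrite mulrC ler_wpM2l//; case/andP: th.
apply: branch_ge => // [|xi bxi]; first by apply: observableZ; exact: observable_low.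
rewrite (eq_bigr (fun y => 1 - h (y + 3 * L))); last by move=> y _; rewrite hM.
rewrite /low_brood; case: (boolP (all _ xi)) => [/allP low|_]; last first.
  by rewrite mulr0; have := pM01 xi; lra.
rewrite mulr1; case: xi bxi low => [//|y xi] _ low.
have := @prod_onem_le1 _ (y :: xi) (fun y => h (y + 3 * L)) y (fun=> h01 _) (mem_head _ _).
by have := low_h (low y (mem_head _ _)); lra.
Qed.

(** When [h (2 * L)] is small, the children of a brood without low members count almost additively,
    which brings in the mean [m0]. On the other broods the term [- k0 h(2 L)] makes the minorant
    nonpositive, since there are at most [k0] children. *)
Lemma quantile_fine : k0%:R * h (2 * L) <= eta ->
  h (2 * L) * ((1 - eta) * m0 - k0%:R * eta) <= U'.
Proof.
set th := h (2 * L) => th_eta; have /andP[th0 th1] : 0 <= th <= 1 := h01 (2 * L).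
apply: (@le_trans _ _ (expect k0 mu (fun xi => th * (1 - k0%:R * th) * (size xi)%:R +
    k0%:R * th * (low_brood B xi + -1)))).
  have osz : observable k0 (fun xi : ragged R => (size xi)%:R : R).
    exact: (observable_size k0 (fun k => k%:R)).
  have ol : observable k0 (fun xi => low_brood B xi + -1).
    by apply: observableD; [exact: observable_low|exact: observable_cst].
  rewrite expectD//; [|exact: observableZ|exact: observableZ].
  rewrite !expectZ// expectD//; [|exact: observable_low|exact: observable_cst].
  rewrite expect_cst//.
  have := law_mean mu_reg; set m := expect _ _ _ => m0m.
  have := low_mu; set l := expect _ _ _ => l_eta.
  have H1 : (1 - eta) * m0 <= (1 - k0%:R * th) * m.
    by apply: ler_pM => //; have := eta_le; have := m0_gt1; lra.
  have H2 : k0%:R * (1 - eta - 1) <= k0%:R * (l - 1) by rewrite ler_wpM2l//; lra.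
  have -> : th * (1 - k0%:R * th) * m + k0%:R * th * (l + -1) =
    th * ((1 - k0%:R * th) * m + k0%:R * (l - 1)) by ring.
  by rewrite ler_wpM2l//; lra.
apply: branch_ge => // [|xi /andP[_ xik]].
  apply: observableD; apply: observableZ.
    exact: (observable_size k0 (fun k => k%:R)).
  by apply: observableD; [exact: observable_low|exact: observable_cst].
rewrite (eq_bigr (fun y => 1 - h (y + 3 * L))); last by move=> y _; rewrite hM.
have {}xik : (size xi)%:R <= k0%:R :> R by rewrite ler_nat.
have sz0 : 0 <= (size xi)%:R :> R by [].
rewrite /low_brood; case: (boolP (all _ xi)) => [/allP low|_]; last first.
  rewrite /= mulr0n add0r mulrN1; have := pM01 xi.
  suff : th * (1 - k0%:R * th) * (size xi)%:R <= k0%:R * th by lra.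
  have : th * (size xi)%:R <= k0%:R * th by rewrite mulrC ler_wpM2r.
  have : 0 <= k0%:R * th * (th * (size xi)%:R) by rewrite !mulr_ge0.
  by lra.
rewrite subrr mulr0 addr0.
have H : \prod_(y <- xi) (1 - h (y + 3 * L)) <= \prod_(y <- xi) (1 - th).
  rewrite !big_seq; apply: ler_prod => y /low/low_h yh.
  by have := h01 (y + 3 * L); rewrite -/th in yh; lra.
have := @prod_onem_le _ xi (fun=> th) (fun=> h01 _).
have -> : \sum_(y <- xi) th = (size xi)%:R * th.
  by rewrite big_const_seq count_predT iter_addr_0 mulr_natl.
have : (size xi)%:R * th * ((size xi)%:R * th) <= k0%:R * th * ((size xi)%:R * th).
  by rewrite ler_wpM2r ?mulr_ge0// ler_wpM2r.
by rewrite expr2; lra.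
Qed.

Let bh d : bounded_meas (fun y => h (y + d)).
Proof.
apply: (bounded_meas_nd (c := 1)) => [y z yz|y]; first by apply: hnd; rewrite lerD2r.
by have /andP[? ?] := h01 (y + d); rewrite ger0_norm.
Qed.

Let bh0 : bounded_meas h.
Proof. by have := bh 0; under eq_fun do rewrite addr0. Qed.

Let bif (c : R) f g : bounded_meas f -> bounded_meas g ->
  bounded_meas (fun y => if y <= c then f y else g y).
Proof. by apply: bounded_meas_if; exact: measurable_ler. Qed.

Let b0 : bounded_meas (fun=> 0 : R). Proof. exact: bounded_meas_cst. Qed.

Let bh2 : bounded_meas (fun y => h y ^+ 2).
Proof. by under eq_fun do rewrite expr2; exact: bounded_measM. Qed.

(** Children up to the cut are estimated by [steep], those beyond it by their shifted value. The
    condition [C * h c <= 1] keeps the minorant [b] nonnegative up to the cut; as also [b <= 2 h]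
    there, its quadratic error is at most [4 k0 h^2]. *)
Lemma cut_lower (c : R) : C * h c <= 1 ->
  (1 + eps) * intensity k0 mu (fun y => if y <= c then h y else 0)
    - (C + 4 * k0%:R) * intensity k0 mu (fun y => if y <= c then h y ^+ 2 else 0)
    + 2^-1 * k0%:R^-1 * intensity k0 mu (fun y => if y <= c then 0 else h (y + 3 * L))
  <= U'.
Proof.
move=> Chc.
set hS := fun y => if y <= c then h y else 0.
set hS2 := fun y => if y <= c then h y ^+ 2 else 0.
set hR := fun y => if y <= c then 0 else h (y + 3 * L).
have bS : bounded_meas hS by exact: bif.
have bS2 : bounded_meas hS2 by exact: bif.
have bR : bounded_meas hR by apply: bif.
pose f xi := (1 + eps) * (\sum_(y <- xi) hS y) +
  (- (C + 4 * k0%:R) * (\sum_(y <- xi) hS2 y) +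
   2^-1 * k0%:R^-1 * (\sum_(y <- xi) hR y)).
have oS := @observable_sum _ k0 _ bS; have oS2 := @observable_sum _ k0 _ bS2.
have oR := @observable_sum _ k0 _ bR.
have of_ : observable k0 f.
  by apply: observableD; [|apply: observableD]; exact: observableZ.
have Ef : expect k0 mu f = (1 + eps) * intensity k0 mu hS
    - (C + 4 * k0%:R) * intensity k0 mu hS2
    + 2^-1 * k0%:R^-1 * intensity k0 mu hR.
  rewrite /f expectD//; [|exact: observableZ|by apply: observableD; exact: observableZ].
  rewrite expectD//; [|exact: observableZ|exact: observableZ].
  by rewrite !expectZ// mulNr addrA.
rewrite -Ef; apply: branch_ge => // xi /andP[_ xik].
rewrite (eq_bigr (fun y => 1 - h (y + 3 * L))); last by move=> y _; rewrite hM.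
pose b y := if y <= c then (1 + eps) * h y - C * h y ^+ 2 else h (y + 3 * L).
have C0 : 0 <= C by have := C_ge8; have := K1; lra.
have hc y : y <= c -> C * h y <= 1.
  by move=> yc; apply: le_trans Chc; rewrite ler_wpM2l// hnd.
have b_le y : b y <= h (y + 3 * L).
  rewrite /b; case: ifP => // _; have := vs (x - y).
  by rewrite /h (_ : x - (y + 3 * L) = x - y - 3 * L)//; ring.
have b01 y : 0 <= b y <= 1.
  rewrite (le_trans (b_le y)) ?andbT; last by case/andP: (h01 (y + 3 * L)).
  rewrite /b; case: ifP => [/hc yc|_]; last by case/andP: (h01 (y + 3 * L)).
  rewrite expr2 mulrA -mulrBl mulr_ge0//; last by case/andP: (h01 y).
  by have := eps_gt0; lra.
have Pb : \prod_(y <- xi) (1 - h (y + 3 * L)) <= \prod_(y <- xi) (1 - b y).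
  apply: ler_prod => y _; have := h01 (y + 3 * L); have := b_le y; lra.
have := prod_onem_le_cut c b01 k0_gt0 xik.
have -> : \sum_(y <- xi) (if y <= c then b y else 0) =
    (1 + eps) * \sum_(y <- xi) hS y - C * \sum_(y <- xi) hS2 y.
  rewrite !big_distrr -sumrB; apply: eq_bigr => y _; rewrite /hS /hS2 /b /=.
  by case: (y <= c); rewrite ?mulr0 ?subr0.
have -> : \sum_(y <- xi) (if y <= c then 0 else b y) = \sum_(y <- xi) hR y.
  by apply: eq_bigr => y _; rewrite /hR /b; case: (y <= c).
have : \sum_(y <- xi) (if y <= c then b y ^+ 2 else 0) <= 4 * \sum_(y <- xi) hS2 y.
  rewrite big_distrr; apply: ler_sum => y _; rewrite /hS2 /= /b.
  case: (boolP (y <= c)) => [/hc yc|_]; last by rewrite mulr0.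
  have h0 := h01 y; have Ch2 : 0 <= C * h y ^+ 2 by rewrite mulr_ge0// sqr_ge0.
  have Chh : C * h y ^+ 2 <= h y.
    by rewrite expr2 mulrA ler_piMl//; case/andP: h0.
  have : (1 + eps) * h y <= 2 * h y.
    by rewrite ler_wpM2r//; [case/andP: h0|have := eps_le; lra].
  have : 0 <= eps * h y by rewrite mulr_ge0//; [exact: ltW|case/andP: h0].
  move=> eh eh2; set u := _ - _.
  have u0 : 0 <= u by rewrite /u; lra.
  have u2 : u <= 2 * h y by rewrite /u; lra.
  by have := ler_pM u0 u0 u2 u2; rewrite !expr2; lra.
set Q := \sum_(y <- xi) (if y <= c then b y ^+ 2 else 0).
move=> QS; have : k0%:R * Q <= k0%:R * (4 * \sum_(y <- xi) hS2 y) by rewrite ler_wpM2l.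
by rewrite /f; lra.
Qed.

(** (MT2) iterated along the grid, from a mean number of children at most [k0]. A full step [L]
    decays by [q^2], of which [q] is enough. *)
Lemma tail_pow n : intensity k0 mu (fun y => (n%:R * L < y)%R%:R) <= q ^+ n * k0%:R.
Proof.
elim: n => [|n IH].
  rewrite expr0; apply: (intensity_le mu_reg (bounded_meas_tail _)) => // y.
  by rewrite lern1 leq_b1.
have -> : (fun y => (n.+1%:R * L < y)%R%:R : R) = (fun y => (n%:R * L + L < y)%R%:R).
  by apply/funext => y; rewrite -[n.+1%:R]natr1 mulrDl mul1r.
apply: (le_trans (law_tail mu_reg _ _)).
- by have := L_M0; have := L_gt0; lra.
- by rewrite mulr_ge0// ltW.
rewrite exprS -mulrA; apply: ler_pM IH; rewrite ?expR_ge0 ?intensity_ge0//.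
by rewrite ler_expR lerN2 ler_wpM2l ?ltW//; have := L_gt0; lra.
Qed.

Section cut.
(** [t] will be [lam * U], and [j.+1] the first grid index at which [h] exceeds [J ^ i * t] or this
    scale exceeds [1 / C]. *)
Variables (t : R) (j : nat).
Hypothesis t_gt0 : 0 < t.
Hypothesis slow : forall i, (i <= j)%N -> h (i.+2%:R * L) <= J ^+ i * t.
Let c := j.+1%:R * L.

Let J0 : 0 < J. Proof. by rewrite /J; have := K1; lra. Qed.

(** Up to [2 L] one factor of [h^2] is at most [t]. From there the bound on [h^2] gains [J^2] per
    grid step while the mean number of children loses [q], and [J^2 q <= 1/2] makes the sum
    geometric. Layer [i] starts at [(i + 2) L], which leaves one spare factor [q]. *)
Lemma slow_square :
  intensity k0 mu (fun y => if y <= c then h y ^+ 2 else 0) <=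
    t * intensity k0 mu h + k0%:R * q * t ^+ 2.
Proof.
pose S n y : R := \sum_(i < n) (J ^+ i.+1 * t) ^+ 2 * (i.+2%:R * L < y)%R%:R.
have S0 n y : 0 <= S n y by apply: sumr_ge0 => i _; rewrite mulr_ge0// sqr_ge0.
have bS n : bounded_meas (S n).
  by apply: bounded_meas_sum => i; apply: bounded_measZ; exact: bounded_meas_tail.
have th0 y : 0 <= t * h y by rewrite mulr_ge0 ?(ltW t_gt0)//; case/andP: (h01 y).
have claim n y : (n <= j)%N -> y <= n.+2%:R * L -> h y ^+ 2 <= t * h y + S n y.
  elim: n => [_ y2|n IH nj yn].
    rewrite /S big_ord0 addr0 expr2 ler_wpM2r//; first by case/andP: (h01 y).
    by apply: le_trans (hnd y2) _; have := slow (leq0n j); rewrite expr0 mul1r.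
  rewrite /S big_ord_recr/= -/(S n y).
  have [yn'|ny] := leP y (n.+2%:R * L).
    by rewrite mulr0 addr0; apply: IH => //; exact: ltnW.
  rewrite mulr1; have hJ := le_trans (hnd yn) (slow nj).
  have /andP[h0 _] := h01 y; have := ler_pM h0 h0 hJ hJ.
  by have := th0 y; have := S0 n y; rewrite !expr2; lra.
(* With [j.-1] layers the claim reaches [(j.-1).+2 L], which is [c] if [j > 0] and [2 L >= c] if
   [j = 0]. *)
apply: (@le_trans _ _ (intensity k0 mu (fun y => t * h y + S j.-1 y))).
  apply: le_intensity => // [||y].
  - exact: bif.
  - by apply: bounded_measD => //; exact: bounded_measZ.
  case: ifP => [yc|_]; last by rewrite addr_ge0.
  apply: claim; first exact: leq_pred.
  apply: le_trans yc _; rewrite /c ler_wpM2r ?(ltW L_gt0)// ler_nat.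
  by case: (j).
rewrite intensityD//; last exact: bounded_measZ.
rewrite intensityZ// lerD2l.
have r0 : 0 <= J ^+ 2 * q by rewrite mulr_ge0 ?sqr_ge0// ltW.
have geo n : \sum_(i < n) (J ^+ 2 * q) ^+ i.+1 <= 1.
  suff : \sum_(i < n) (J ^+ 2 * q) ^+ i.+1 <= 1 - 2^-1 ^+ n.
    have : 0 <= (2^-1 : R) ^+ n by apply: exprn_ge0.
    by lra.
  elim: n => [|n IH]; first by rewrite big_ord0 expr0 subrr.
  rewrite big_ord_recr/=.
  have : (J ^+ 2 * q) ^+ n.+1 <= 2^-1 ^+ n.+1.
    by rewrite lerXn2r// nnegrE.
  by rewrite !exprS in IH *; lra.
rewrite (intensity_sum mu_reg); last first.
  by move=> i; apply: bounded_measZ; exact: bounded_meas_tail.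
apply: (@le_trans _ _ (\sum_(i < j.-1) k0%:R * q * t ^+ 2 * (J ^+ 2 * q) ^+ i.+1)).
  apply: ler_sum => i _; rewrite intensityZ//; last exact: bounded_meas_tail.
  apply: (@le_trans _ _ ((J ^+ i.+1 * t) ^+ 2 * (q ^+ i.+2 * k0%:R))).
    by rewrite ler_wpM2l ?sqr_ge0// tail_pow.
  rewrite le_eqVlt; apply/orP; left; apply/eqP.
  by rewrite exprMn (exprS q) [in RHS]exprMn -!exprM [(2 * _)%N]mulnC; ring.
rewrite -big_distrr/= ler_piMr//.
  by rewrite !mulr_ge0// ?sqr_ge0// ltW.
exact: geo.
Qed.

(** Between [c] and [c + L], [h] is still at most [J ^ j * t], while the shift by [3 L] carries the
    child past the jump and gains the factor [J]. Beyond [c + L], the displacement tail itself gives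
    the factor [q <= 1 / J]. *)
Lemma jump_tail : J ^+ j.+1 * t < h (j.+3%:R * L) ->
  intensity k0 mu (fun y => if y <= c then 0 else h y) <=
    (4 * k0%:R)^-1 * intensity k0 mu (fun y => if y <= c then 0 else h (y + 3 * L)).
Proof.
move=> jump; set hR := (X in _ * intensity k0 mu X).
have bR : bounded_meas hR by exact: bif.
have H0 : 0 <= intensity k0 mu hR.
  by apply: intensity_ge0 => y; rewrite /hR; case: ifP => // _; case/andP: (h01 (y + 3 * L)).
have cL : c + L = j.+2%:R * L by rewrite /c -[j.+2%:R]natr1 mulrDl mul1r.
have cLL : c + 2 * L = j.+3%:R * L.
  by rewrite -[j.+3%:R]natr1 [RHS]mulrDl mul1r -cL; ring.
have bhR : bounded_meas (fun y => if y <= c + L then 0 else h y) by exact: bif.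
apply: (@le_trans _ _ (intensity k0 mu (fun y => J^-1 * hR y + (if y <= c + L then 0 else h y)))).
  apply: le_intensity => // [||y]; first exact: bif.
    by apply: bounded_measD => //; exact: bounded_measZ.
  rewrite /hR; case: ifPn => [yc|].
    by rewrite mulr0 add0r; case: ifP => // _; case/andP: (h01 y).
  rewrite -ltNge => cy; have [ycL|_] := leP y (c + L); last first.
    by rewrite lerDr mulr_ge0 ?invr_ge0 ?(ltW J0)//; case/andP: (h01 (y + 3 * L)).
  rewrite addr0 ler_pdivlMl//.
  apply: (@le_trans _ _ (J * (J ^+ j * t))).
    rewrite ler_pM2l//; apply: le_trans (slow (leqnn j)); apply: hnd.
    by rewrite -cL.
  rewrite mulrA -exprS; apply: le_trans (ltW jump) _; apply: hnd.
  by rewrite -cLL; have := L_gt0; lra.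
rewrite intensityD//; last exact: bounded_measZ.
rewrite intensityZ//.
have c0 : 0 <= c by rewrite /c mulr_ge0// ltW.
have := intensity_shift_nd mu_reg c0 L_M0 L_gt0 hnd h01; rewrite -/q => F.
have : intensity k0 mu (fun y => if y <= c then 0 else h (y + L)) <= intensity k0 mu hR.
  apply: le_intensity => // [|y]; first exact: bif.
  rewrite /hR; case: ifP => // _; apply: hnd.
  by have := L_gt0; lra.
set H' := intensity k0 mu (fun y => if y <= c then 0 else h (y + L)) in F *.
set H := intensity k0 mu hR in H0 * => H'H.
have qJ : q <= J^-1.
  have J1 : 1 <= J by rewrite /J; have := K1; lra.
  rewrite -(ler_pM2l J0) mulfV ?gt_eqF//.
  apply: (@le_trans _ _ (J ^+ 2 * q)); last by have := r_le; lra.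
  by rewrite expr2 -mulrA ler_peMl// mulr_ge0// ltW.
have qH : q * H' <= J^-1 * H.
  apply: (@le_trans _ _ (q * H)); first by rewrite ler_pM2l.
  by rewrite ler_wpM2r.
have -> : (4 * k0%:R)^-1 = J^-1 + J^-1.
  by rewrite /J !invfM; have : k0%:R != 0 :> R; [rewrite pnatr_eq0 -lt0n|move=> ?; field].
by rewrite mulrDl; lra.
Qed.

(** The trivial bound [h <= 1] is good enough here: [level] allows the factor [(C J^(j+1) t)^2 >= 1]
    to be inserted, which turns the tail [q^(j+1)] into a multiple of [t^2]. *)
Lemma level_tail : 1 < C * (J ^+ j.+1 * t) ->
  intensity k0 mu (fun y => if y <= c then 0 else h y) <=
    k0%:R * C ^+ 2 * (J ^+ 2 * q) * t ^+ 2.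
Proof.
move=> level.
apply: (@le_trans _ _ (intensity k0 mu (fun y => (c < y)%R%:R))).
  apply: le_intensity => // [||y]; [exact: bif|exact: bounded_meas_tail|].
  by case: ltP => // _; case/andP: (h01 y).
apply: le_trans (tail_pow _) _.
have r0 : 0 <= J ^+ 2 * q by rewrite mulr_ge0 ?sqr_ge0// ltW.
have qj : 0 <= q ^+ j.+1 by rewrite exprn_ge0// ltW.
have lev2 : 1 <= (C * (J ^+ j.+1 * t)) ^+ 2 by rewrite exprn_ege1// ltW.
apply: (@le_trans _ _ (q ^+ j.+1 * (C * (J ^+ j.+1 * t)) ^+ 2 * k0%:R)).
  by rewrite ler_wpM2r// ler_peMr.
have -> : q ^+ j.+1 * (C * (J ^+ j.+1 * t)) ^+ 2 * k0%:R =
    k0%:R * C ^+ 2 * (J ^+ 2 * q) * t ^+ 2 * (J ^+ 2 * q) ^+ j.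
  move: (J) (q) (C) => z p e; rewrite !exprMn [z ^+ j.+1 ^+ 2]exprAC.
  by rewrite !(exprS _ j) [z ^+ 2 ^+ j]exprMn; ring.
rewrite ler_piMr//; first by rewrite mulr_ge0 ?sqr_ge0// mulr_ge0// mulr_ge0 ?sqr_ge0.
by apply: exprn_ile1 => //; have := r_le; lra.
Qed.

End cut.
Lemma steep_branch_at : (1 + eps) * U - C * U ^+ 2 <= U'.
Proof.
have [//|ltU] := leP ((1 + eps) * U - C * U ^+ 2) U'; exfalso.
have [Uni U01] := tail_branch mub vt.
have UU' : U <= U' by apply: Uni; have := L_gt0; lra.
have U0 : 0 <= U by case/andP: (U01 x).
have C0 : 0 < C by have := C_ge8; have := K1; lra.
have CU2 : 0 <= C * U ^+ 2 by rewrite mulr_ge0 ?sqr_ge0 ?ltW.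
have Upos : 0 < U.
  rewrite lt_neqAle U0 andbT; apply/eqP => UE.
  by move: ltU UU'; rewrite -UE; lra.
have CU : C * U < eps.
  by rewrite -(ltr_pM2r Upos); rewrite expr2 in ltU CU2; lra.
have /andP[th0 th1] := h01 (2 * L).
(* The sharp bound on [h (2 * L)] presupposes that this value is small. The crude bound, together
   with [C U < eps], supplies this. *)
have th4 : h (2 * L) <= 4 * U.
  have H1 : 2^-1 * h (2 * L) <= (1 - eta) * h (2 * L).
    by rewrite ler_wpM2r//; have := eta_le; lra.
  have H2 : eps * U <= 4^-1 * U by rewrite ler_wpM2r// eps_le.
  by have := quantile_crude; lra.
have k_th : k0%:R * h (2 * L) <= eta.
  rewrite -(ler_pM2r C0); apply: le_trans C_eta.
  have H1 : k0%:R * (C * h (2 * L)) <= k0%:R * (4 * eps).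
    rewrite ler_wpM2l//.
    have : C * h (2 * L) <= C * (4 * U) by rewrite ler_pM2l.
    by lra.
  by lra.
pose t := lam * U.
have t0 : 0 < t by rewrite mulr_gt0.
have tU : t <= U by rewrite /t ler_piMl// ltW.
have th_t : h (2 * L) <= t.
  have e1 : 0 < 1 + eps by have := eps_gt0; lra.
  rewrite -(ler_pM2l e1) /t.
  have H1 : h (2 * L) * (1 + eps) <= h (2 * L) * (lam * ((1 - eta) * m0 - k0%:R * eta)).
    by rewrite ler_wpM2l.
  have H2 : lam * (h (2 * L) * ((1 - eta) * m0 - k0%:R * eta)) <= lam * U'.
    by rewrite ler_pM2l//; exact: quantile_fine.
  have H3 : lam * U' <= lam * ((1 + eps) * U) by rewrite ler_pM2l//; lra.
  by lra.
have Ct : C * t <= 1.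
  have : C * t <= C * U by rewrite ler_pM2l.
  by have := eps_le; lra.
have J1 : 1 < J by rewrite /J; have := K1; lra.
(* The second alternative ensures that the search ends even if [h] never jumps, because [J > 1]. *)
pose fast i := (J ^+ i * t < h (i.+2%:R * L)) || (1 < C * (J ^+ i * t)).
have exf : exists i, fast i.
  exists (Num.Def.archi_bound (C * t)^-1); apply/orP; right.
  have Ct0 : 0 < C * t by rewrite mulr_gt0.
  rewrite mulrCA -ltr_pdivrMr// mul1r.
  apply: lt_le_trans (archi_boundP _) _; first by rewrite invr_ge0 ltW.
  set n := Num.Def.archi_bound _.
  have nJ : forall n : nat, n%:R <= J ^+ n.
    elim=> [|i IH]; first by rewrite expr0 ler01.
    rewrite exprS -[i.+1%:R]natr1.
    have J8 : 8 <= J by rewrite /J; have := K1; lra.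
    have Ji : 1 <= J ^+ i by rewrite exprn_ege1// ltW.
    have : 8 * J ^+ i <= J * J ^+ i by rewrite ler_wpM2r//; lra.
    by lra.
  exact: nJ.
(* Index 0 is excluded by [h (2 * L) <= t] and [C t <= 1], so the first fast index is a successor
   and the grid is slow up to its predecessor [j]. *)
case: (ex_minnP exf) => -[|j] fastj minj.
  by move: fastj; rewrite /fast expr0 mul1r => /orP[]; rewrite ltNge ?th_t ?Ct.
have slow i : (i <= j)%N -> h (i.+2%:R * L) <= J ^+ i * t.
  move=> ij; rewrite leNgt; apply/negP => H.
  by have := minj i; rewrite /fast H => /(_ isT); rewrite ltnNge ij.
have levj : C * (J ^+ j * t) <= 1.
  rewrite leNgt; apply/negP => H.
  by have := minj j; rewrite /fast H orbT => /(_ isT); rewrite ltnn.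
set c := j.+1%:R * L.
have Chc : C * h c <= 1.
  apply: le_trans levj; rewrite ler_pM2l//; apply: le_trans (slow j (leqnn j)).
  by apply: hnd; rewrite /c ler_wpM2r ?(ltW L_gt0)// ler_nat.
have low := cut_lower Chc.
have sq := slow_square t0 slow; rewrite -/c in sq.
set NS := intensity k0 mu (fun y => if y <= c then h y else 0) in low.
set NS2 := intensity k0 mu (fun y => if y <= c then h y ^+ 2 else 0) in low sq.
set H := intensity k0 mu (fun y => if y <= c then 0 else h (y + 3 * L)) in low.
pose NR := intensity k0 mu (fun y => if y <= c then 0 else h y).
set A := intensity k0 mu h in sq.
have AE : A = NS + NR.
  rewrite /A /NS /NR -intensityD//; [|exact: bif|exact: bif].
  by congr intensity; apply/funext => y; case: ifP => _; rewrite ?addr0 ?add0r.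
have UA : U <= A by exact: branch_le_intensity.
have H0 : 0 <= H.
  by apply: intensity_ge0 => y; case: ifP => // _; case/andP: (h01 (y + 3 * L)).
have NR0 : 0 <= NR.
  by apply: intensity_ge0 => y; case: ifP => // _; case/andP: (h01 y).
have Kn0 : k0%:R != 0 :> R by rewrite pnatr_eq0 -lt0n.
have wH : 0 <= 2^-1 * k0%:R^-1 * H by rewrite mulr_ge0// mulr_ge0// invr_ge0.
have Lq := L_q; have rle := r_le; set r := J ^+ 2 * q in Lq rle.
have r0 : 0 <= r by rewrite /r mulr_ge0 ?sqr_ge0// ltW.
set far := 2 * (k0%:R * C ^+ 2 * r * t ^+ 2).
have far0 : 0 <= far.
  by rewrite mulr_ge0// mulr_ge0 ?sqr_ge0// mulr_ge0// mulr_ge0 ?sqr_ge0.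
have e2 : (1 + eps) * NR <= 2 * NR by rewrite ler_wpM2r//; have := eps_le; lra.
have {low} low : (1 + eps) * A - (C + 4 * k0%:R) * NS2 - far <= U'.
  (* The children beyond the cut are missing from [NS]. Their share [2 NR] is paid by the shifted
     sum [H] after a jump, and otherwise charged to [far]. *)
  suff : (1 + eps) * NR <= 2^-1 * k0%:R^-1 * H + far by rewrite AE; lra.
  apply: le_trans e2 _; case/orP: fastj => [jump|level].
    have := jump_tail slow jump; rewrite -/c -/NR -/H => NRH.
    have E : (4 * k0%:R)^-1 * H = 2^-1 * (2^-1 * k0%:R^-1 * H) by field.
    by rewrite E in NRH; lra.
  have := level_tail level; rewrite -/c -/NR -/r => NRf.
  by rewrite /far; lra.
have qr : q <= r.
  have J2 : 1 <= J ^+ 2 by rewrite exprn_ege1// ltW.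
  by rewrite /r ler_peMl// ltW.
have := absorb_error K1 C_ge8 C_lam eps_gt0 eps_le lam_gt0 lam_lt1 Upos CU UA
  (ltW q_gt0) qr Lq sq low.
by rewrite leNgt ltU.
Qed.
End at_point.

Lemma steep_branch v : tail_function v -> steep eps C (3 * L) v ->
  steep eps C (3 * L) (branch k0 mu v).
Proof. by move=> vt vs x; exact: steep_branch_at. Qed.

End steepness.

(** * Concentration *)

Section left_tail.
Context (R : realType) (k0 : nat).

Section one_step.
Context (mu : probability (ragged R) R).
Hypothesis mub : mu (brood k0) = 1%E.
Hypothesis k0_gt0 : (0 < k0)%N.

(** Union bound over at most [k0] children, none of them displaced beyond [B] outside an event of
    probability at most [eta]. *)
Lemma branch_shift_le v (eta B x : R) : tail_function v -> 0 <= eta ->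
  1 - eta <= expect k0 mu (high_brood B) ->
  branch k0 mu v (x + B) <= eta + k0%:R * v x.
Proof.
move=> vt eta0 hB; have /andP[v0 v1] := vt.2 x.
suff H : expect k0 mu (fun xi => high_brood B xi + - (k0%:R * v x)) <=
    expect k0 mu (fun xi => \prod_(y <- xi) (1 - v (x + B - y))).
  rewrite expectD// in H; [|exact: observable_high|exact: observable_cst].
  by rewrite expect_cst// in H; rewrite /branch; lra.
apply: le_expect => // [||xi /andP[_ xik]].
- by apply: observableD; [exact: observable_high|exact: observable_cst].
- exact: observable_branch_tail.
have kv : 0 <= k0%:R * v x by rewrite mulr_ge0.
have p01 : 0 <= \prod_(y <- xi) (1 - v (x + B - y)) <= 1.
  by apply: prod_itv01 => y; have := vt.2 (x + B - y); lra.
rewrite /high_brood; case: (boolP (all _ xi)) => [/allP hi|_]; last first.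
  by rewrite /= mulr0n add0r; lra.
have := @prod_onem_ge _ xi (fun y => v (x + B - y)) (fun y => vt.2 (x + B - y)).
have : \sum_(y <- xi) v (x + B - y) <= k0%:R * v x.
  apply: (@le_trans _ _ ((size xi)%:R * v x)); last by rewrite ler_wpM2r// ler_nat.
  by apply: sum_le_size => y /hi yB; apply: vt.1; lra.
by rewrite /=; lra.
Qed.

(** If no child is low, the product is at most [(1 - v)^K] with [K] the brood size, and
    [(1 - v)^(K - 1) <= 1 - v (K - 1) / k0] for [1 <= K <= k0]. This bound is linear in [K], so only
    the mean of [K] enters. *)
Lemma branch_shift_ge v (m eta B x : R) : tail_function v -> 0 <= eta ->
  m <= expect k0 mu (fun xi => (size xi)%:R) ->
  1 - eta <= expect k0 mu (low_brood B) ->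
  1 - branch k0 mu v (x - B) <= eta + (1 - (m - 1) / k0%:R * v x) * (1 - v x).
Proof.
move=> vt eta0 mm lB; have /andP[v0 v1] := vt.2 x.
have kp : 0 < k0%:R :> R by rewrite ltr0n.
rewrite /branch opprB addrC subrK.
pose rhs xi : R := 1 + (-1) * low_brood B xi +
  (1 - v x) * (1 + - (v x / k0%:R) * ((size xi)%:R + -1)).
have osz : observable k0 (fun xi : ragged R => (size xi)%:R + -1 : R).
  exact: (observable_size k0 (fun k => k%:R + -1)).
have osz0 : observable k0 (fun xi : ragged R => (size xi)%:R : R).
  exact: (observable_size k0 (fun k => k%:R)).
have o1 : observable k0 (fun xi => 1 + (-1) * low_brood B xi).
  by apply: observableD; [exact: observable_cst|apply: observableZ; exact: observable_low].
have o2 : observable k0 (fun xi : ragged R => 1 + - (v x / k0%:R) * ((size xi)%:R + -1)).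
  by apply: observableD; [exact: observable_cst|exact: observableZ].
apply: (@le_trans _ _ (expect k0 mu rhs)).
  apply: le_expect => // [||xi /andP[xi0 xik]].
  - exact: observable_branch_tail.
  - by apply: observableD => //; exact: observableZ.
  rewrite /rhs /low_brood.
  have p01 : 0 <= \prod_(y <- xi) (1 - v (x - B - y)) <= 1.
    by apply: prod_itv01 => y; have := vt.2 (x - B - y); lra.
  have sk : ((size xi)%:R - 1) / k0%:R <= 1 :> R.
    by rewrite ler_pdivrMr// mul1r; have : (size xi)%:R <= k0%:R :> R; [rewrite ler_nat|lra].
  have s1 : 1 <= (size xi)%:R :> R by rewrite ler1n.
  have sk0 : 0 <= ((size xi)%:R - 1) / k0%:R :> R by rewrite divr_ge0//; lra.
  set w := ((size xi)%:R - 1) / k0%:R in sk sk0.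
  have -> : - (v x / k0%:R) * ((size xi)%:R + -1) = - (v x * w).
    by rewrite /w; ring.
  have vw : 0 <= v x * w by rewrite mulr_ge0.
  have vw1 : v x * w <= v x by rewrite ler_piMr.
  have vvw : 0 <= (1 - v x) * (1 - v x * w) by rewrite mulr_ge0//; lra.
  case: (boolP (all _ xi)) => [/allP lo|_]; last by rewrite /= mulr0n mulr0; lra.
  rewrite /= mulr1 subrr add0r.
  have pv : \prod_(y <- xi) (1 - v (x - B - y)) <= \prod_(y <- xi) (1 - v x).
    rewrite !big_seq; apply: ler_prod => y /lo yB.
    by have := vt.2 (x - B - y); have : v x <= v (x - B - y); [apply: vt.1; lra|lra].
  apply: le_trans pv _; clear p01 vvw.
  case: xi xi0 xik lo @w s1 sk sk0 vw vw1 => [//|y [|z xi]] _ _ _ w s1 sk sk0 vw vw1.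
    by rewrite big_seq1 /w subrr mul0r mulr0 subr0 mulr1.
  rewrite !big_cons ler_wpM2l//; first lra.
  have : 0 <= \prod_(j <- xi) (1 - v x) <= 1 by apply: prod_itv01 => _; lra.
  by move=> p01; apply: (@le_trans _ _ (1 - v x)); [rewrite ler_piMr//; lra|lra].
rewrite /rhs expectD//; last exact: observableZ.
rewrite expectZ// expectD//; [|exact: observable_cst|by apply: observableZ; exact: observable_low].
rewrite expectD//; [|exact: observable_cst|exact: observableZ].
rewrite !expectZ//; last exact: observable_low.
rewrite expectD//; last exact: observable_cst.
rewrite !expect_cst//.
set s := expect k0 mu (fun xi => (size xi)%:R) in mm *.
apply: lerD; first by lra.
rewrite mulrC ler_wpM2r//; first lra.
rewrite lerD2l mulNr lerN2.
have -> : v x / k0%:R * (s + -1) = (s - 1) / k0%:R * v x by ring.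
by rewrite ler_wpM2r// ler_wpM2r ?invr_ge0//; lra.
Qed.

End one_step.

(** Below [eps / (2 C)] the quadratic term takes at most half of the gain, so every step [M] divides
    [v] by [1 + eps / 2]. Bernoulli's bound [1 + k eps / 2] for the resulting power already gives a
    [D] that is the same for all [v]. *)
Lemma steep_decay (eps C M s : R) : 0 < eps -> 0 < C -> 0 < M -> 0 < s ->
  exists2 D, 0 <= D & forall v x, tail_function v -> steep eps C M v ->
    v x <= eps / (2 * C) -> v (x + D) <= s.
Proof.
move=> e0 C0 M0 s0; pose n := Num.Def.archi_bound (2 / (eps * s)).
have es0 : 0 < eps * s by rewrite mulr_gt0.
exists (n%:R * M) => [|v x vt vs vx]; first by rewrite mulr_ge0// ltW.
have nes : 2 <= n%:R * (eps * s).
  rewrite -ler_pdivrMr//; apply: ltW; apply: archi_boundP.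
  by rewrite divr_ge0// ltW.
suff claim k : (1 + k%:R * (eps / 2)) * v (x + k%:R * M) <= 1.
  have := claim n; set w := v _ => wn.
  have w0 : 0 <= w by case/andP: (vt.2 (x + n%:R * M)).
  have : s^-1 * w <= 1.
    apply: le_trans wn; rewrite ler_wpM2r//.
    apply: (@le_trans _ _ (n%:R * (eps / 2))); last by lra.
    rewrite -div1r ler_pdivrMr//; lra.
  by rewrite mulrC ler_pdivrMr// mul1r.
elim: k => [|k IH].
  by rewrite mul0r addr0 mul1r mul0r addr0; case/andP: (vt.2 x).
set w := v (x + k.+1%:R * M); have /andP[w0 w1] : 0 <= w <= 1 := vt.2 _.
have wx : w <= eps / (2 * C).
  by apply: le_trans vx; apply: vt.1; rewrite lerDl mulr_ge0// ltW.
have H : (1 + eps / 2) * w <= v (x + k%:R * M).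
  have := vs (x + k.+1%:R * M); rewrite -/w.
  have -> : x + k.+1%:R * M - M = x + k%:R * M by rewrite -[k.+1%:R]natr1; ring.
  apply: le_trans; have : C * w * w <= eps / 2 * w.
    rewrite ler_wpM2r//; apply: (@le_trans _ _ (C * (eps / (2 * C)))).
      by rewrite ler_pM2l.
    by rewrite le_eqVlt; apply/orP; left; apply/eqP; field; rewrite gt_eqF.
  by rewrite expr2; lra.
have k_ge0 : 0 <= 1 + k%:R * (eps / 2) by rewrite addr_ge0// mulr_ge0// divr_ge0// ltW.
apply: le_trans IH.
apply: (@le_trans _ _ ((1 + k%:R * (eps / 2)) * ((1 + eps / 2) * w))); last first.
  by rewrite ler_wpM2l.
rewrite [leRHS]mulrA ler_wpM2r// -[k.+1%:R]natr1.
have : 0 <= k%:R * (eps / 2) * (eps / 2) by rewrite !mulr_ge0// ?invr_ge0// ltW.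
by lra.
Qed.

(** The order of the quantifiers matters: (GT) produces [B] from [eta], so [eta], [eps] and [C]
    precede [B], and [M] alone depends on it. The bound [eps <= C] is what the initial tail
    requires. *)
Lemma steep_constants (m0 a M0 : R) : 1 < m0 -> 0 < a -> (0 < k0)%N ->
  exists eta eps C : R, [/\ 0 < eta, 0 < eps, 0 < C, eps <= C &
    forall B, exists2 M : R, 0 < M &
    forall mu v, regular_law k0 m0 a M0 mu ->
      1 - eta <= expect k0 mu (low_brood B) ->
      tail_function v -> steep eps C M v -> steep eps C M (branch k0 mu v)].
Proof.
move=> m1 a0 k00; have K1 : 1 <= k0%:R :> R by rewrite ler1n.
(* Of [m0 = 1 + 3 tau], one [tau] is given up to [eta], one leaves room for [eps], and the last
   makes [lam < 1]. *)
pose tau := (m0 - 1) / 3; have tau0 : 0 < tau by rewrite /tau; lra.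
have mk0 : 0 < m0 + k0%:R by lra.
pose eta := Num.min 2^-1 (tau / (m0 + k0%:R)).
have eta0 : 0 < eta by rewrite lt_min invr_gt0 ltr0n divr_gt0.
have eta2 : eta <= 2^-1 by rewrite ge_min lexx.
have eta_tau : eta * (m0 + k0%:R) <= tau.
  by rewrite -ler_pdivlMr// ge_min lexx orbT.
pose eps := Num.min 4^-1 tau.
have eps0 : 0 < eps by rewrite lt_min invr_gt0 ltr0n.
have eps4 : eps <= 4^-1 by rewrite ge_min lexx.
have eps_tau : eps <= tau by rewrite ge_min lexx orbT.
pose lam := (1 + tau) / (1 + 2 * tau).
have tau2 : 0 < 1 + 2 * tau by lra.
have lam0 : 0 < lam by rewrite divr_gt0//; lra.
have lam1 : lam < 1 by rewrite ltr_pdivrMr//; lra.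
have lamE : 1 + eps <= lam * ((1 - eta) * m0 - k0%:R * eta).
  apply: (@le_trans _ _ (lam * (1 + 2 * tau))); first by rewrite divfK ?gt_eqF//; lra.
  by rewrite ler_pM2l//; move: eta_tau; rewrite /tau; lra.
have l1 : 0 < 1 - lam by lra.
(* The first summand serves [C_eta], the second [C_lam]. *)
pose C := 4 * eps * k0%:R / eta + 8 * k0%:R / (1 - lam).
have C1 : 0 <= 4 * eps * k0%:R / eta by rewrite divr_ge0 ?mulr_ge0// ltW.
have C2 : 8 * k0%:R <= 8 * k0%:R / (1 - lam) by rewrite ler_peMr ?invf_ge1//; lra.
have C8 : 8 * k0%:R <= C by rewrite /C; lra.
have C0 : 0 < C by lra.
exists eta, eps, C; split => // [|B]; first lra.
pose W := (8 * k0%:R) ^+ 2 * (C + C ^+ 2).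
have W0 : 0 <= W by rewrite mulr_ge0 ?sqr_ge0// addr_ge0 ?sqr_ge0// ltW.
(* The last summand gives [a L / 2 >= W], hence [W exp(- a L / 2) <= 1] by [exp x >= 1 + x]. *)
pose L := `|B| + 2 * `|M0| + 1 + 2 * W / a.
have Wa : 0 <= W / a by rewrite divr_ge0// ltW.
have := ler_norm B; have := ler_norm M0; have := normr_ge0 B; have := normr_ge0 M0.
move=> M00 B00 M0M BB.
have L0 : 0 < L by rewrite /L; lra.
exists (3 * L) => [|mu v mu_reg lowB vt vs]; first lra.
apply: (steep_branch (lam := lam) mu_reg k00 a0 lowB) vt vs => //.
- rewrite /C mulrDr mulrCA mulfV ?gt_eqF// mulr1 lerDl mulr_ge0//; first exact: ltW.
  by rewrite divr_ge0 ?mulr_ge0// ltW.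
- rewrite /C mulrDr [X in _ <= _ + X]mulrC divfK ?gt_eqF// lerDr mulr_ge0//; exact: ltW.
- by rewrite /L; lra.
- by rewrite /L; lra.
rewrite mulrAC -/W mulrC expRN ler_pdivrMl ?expR_gt0// mulr1.
apply: le_trans (expR_ge1Dx _).
have : a * (W / a) <= a * (L / 2) by rewrite ler_pM2l// /L; lra.
by rewrite mulrC divfK ?gt_eqF//; lra.
Qed.

End left_tail.

(** * Concentration uniform over the generations *)

Section cascade.
Context (R : realType) (k0 : nat) (mu : nat -> probability (ragged R) R).

(* Tail of the maximum, after i further generations, of the offspring of a
   particle of generation m located at 0. *)
Fixpoint cascade (i m : nat) : R -> R :=
  if i is i'.+1 then branch k0 (mu m) (cascade i' m.+1)
  else fun x => (x < 0)%R%:R.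

Hypothesis mub : forall m, mu m (brood k0) = 1%E.

Lemma tail_cascade i m : tail_function (cascade i m).
Proof.
elim: i m => [|i IH] m; last exact: tail_branch.
split=> [x y xy|x] /=; last by rewrite ler0n lern1 leq_b1.
by rewrite ler_nat; case: (ltP y 0) => // y0; rewrite (le_lt_trans xy y0).
Qed.

End cascade.

Section cascade_concentration.
Context (R : realType) (k0 : nat) (m0 a M0 : R) (mu : nat -> probability (ragged R) R).
Hypothesis k0_gt0 : (0 < k0)%N.
Hypothesis m0_gt1 : 1 < m0.
Hypothesis a_gt0 : 0 < a.
Hypothesis mu_reg : forall m, regular_law k0 m0 a M0 (mu m).
Hypothesis mu_tight : forall eta : R, 0 < eta -> exists2 B : R, 0 < B &
  forall m, 1 - eta <= expect k0 (mu m) (low_brood B) /\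
            1 - eta <= expect k0 (mu m) (high_brood B).

Let mub m := law_brood (mu_reg m).
Local Notation u_ := (cascade k0 mu).

Let tail_u i m : tail_function (u_ i m).
Proof. exact: tail_cascade. Qed.

Let K1 : 1 <= k0%:R :> R. Proof. by rewrite ler1n. Qed.

(** Each generation multiplies by [k0] and adds [eta]; enlarging the factor to [k0 + 1] absorbs the
    added errors. *)
Lemma cascade_upper eta B : 0 <= eta ->
  (forall m, 1 - eta <= expect k0 (mu m) (high_brood B)) ->
  forall j i m x, u_ (j + i) m (x + j%:R * B) <=
    (k0.+1%:R) ^+ j * (u_ i (m + j)%N x + eta).
Proof.
move=> eta0 hB j i; elim: j => [|j IH] m x.
  by rewrite add0n mul0r addr0 expr0 mul1r addn0 lerDl.
have := branch_shift_le (mub m) (x + j%:R * B) (tail_u (j + i) m.+1) eta0 (hB m).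
have -> : x + j%:R * B + B = x + j.+1%:R * B by rewrite -[j.+1%:R]natr1; ring.
move/le_trans; apply.
have {}IH := IH m.+1 x; rewrite addSnnS in IH.
set c := u_ i _ x in IH *.
have c0 : 0 <= c by case/andP: ((tail_u i (m + j.+1)).2 x).
have kj : 1 <= (k0.+1%:R : R) ^+ j by rewrite exprn_ege1// ler1n.
set X := k0.+1%:R ^+ j in IH kj *.
have H1 : k0%:R * u_ (j + i) m.+1 (x + j%:R * B) <= k0%:R * (X * (c + eta)).
  by rewrite ler_wpM2l.
have H2 : 1 * (c + eta) <= X * (c + eta) by rewrite ler_wpM2r// addr_ge0.
have -> : k0.+1%:R ^+ j.+1 * (c + eta) = k0%:R * (X * (c + eta)) + X * (c + eta).
  by rewrite exprS -/X -[k0.+1%:R]natr1; ring.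
by lra.
Qed.

(** The level [delta] is inherited from one generation to the next, so each of them contracts
    [1 - u] by the same factor [1 - rho delta]. The errors [rho delta e / 2] are chosen to add up to
    at most [e / 2] in the resulting geometric series. *)
Lemma cascade_lower rho delta e B : 0 <= rho -> rho <= (m0 - 1) / k0%:R ->
  0 < delta <= 1 -> e / 2 <= 1 - delta -> rho * delta <= 1 -> 0 <= e ->
  (forall m, 1 - rho * delta * (e / 2) <= expect k0 (mu m) (low_brood B)) ->
  forall j i m x, delta <= u_ i (m + j)%N x ->
    delta <= u_ (j + i) m (x - j%:R * B) /\
    1 - u_ (j + i) m (x - j%:R * B) <=
      e / 2 + (1 - rho * delta) ^+ j * (1 - u_ i (m + j)%N x).
Proof.
move=> rho0 rhoE /andP[d0 d1] ed rd e0 lB j i.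
have rde : 0 <= rho * delta * (e / 2).
  by rewrite mulr_ge0// ?divr_ge0// mulr_ge0// ltW.
elim: j => [|j IH] m x dx.
  by rewrite add0n mul0r subr0 expr0 mul1r addn0 in dx *; split => //; lra.
have := IH m.+1 x; rewrite addSnnS => /(_ dx)[{}IH1 {}IH2].
have := branch_shift_ge (mub m) k0_gt0 (x - j%:R * B) (tail_u (j + i) m.+1) rde
  (law_mean (mu_reg m)) (lB m).
have -> : x - j%:R * B - B = x - j.+1%:R * B by rewrite -[j.+1%:R]natr1; ring.
set v := u_ (j + i) m.+1 _ in IH1 IH2 *.
set u := u_ (j.+1 + i) m _ => uv.
have {}uv : 1 - u <= rho * delta * (e / 2) + (1 - (m0 - 1) / k0%:R * v) * (1 - v) := uv.
set w := u_ i _ x in dx IH2 *.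
have /andP[v0 v1] : 0 <= v <= 1 by exact: (tail_u (j + i) m.+1).2.
have H : (1 - (m0 - 1) / k0%:R * v) * (1 - v) <= (1 - rho * delta) * (1 - v).
  rewrite ler_wpM2r//; first lra.
  by rewrite lerD2l lerN2 ler_pM// ltW.
have H1 : (1 - rho * delta) * (1 - v) <= (1 - rho * delta) * (1 - delta).
  by rewrite ler_wpM2l//; lra.
have H2 : (1 - rho * delta) * (1 - v) <=
    (1 - rho * delta) * (e / 2 + (1 - rho * delta) ^+ j * (1 - w)).
  by rewrite ler_wpM2l//; lra.
have H3 : rho * delta * (e / 2) <= rho * delta * (1 - delta).
  by rewrite ler_wpM2l// mulr_ge0// ltW.
rewrite exprS; move: ((1 - rho * delta) ^+ j) H2 => X H2.
by split; lra.
Qed.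

(** The margin 1 on either side avoids evaluating the tail at a possible jump. The bounds used to
    make the quantile finite depend on [i], which is harmless as they do not enter the
    conclusion. *)
Lemma cascade_quantile delta i m : 0 < delta < 1 ->
  exists x, u_ i m (x + 1) <= delta /\ delta <= u_ i m (x - 1).
Proof.
move=> /andP[d0 d1].
have [x1 Hx1] : exists x, u_ i m x <= delta / 2.
  pose eta := delta / (2 * k0.+1%:R ^+ i).
  have X0 : 0 < (k0.+1%:R : R) ^+ i by rewrite exprn_gt0.
  have eta0 : 0 < eta by rewrite divr_gt0// mulr_gt0.
  have [B _ HB] := mu_tight eta0.
  exists (0 + i%:R * B).
  have := cascade_upper (ltW eta0) (fun m => (HB m).2) i 0 m 0.
  rewrite addn0 /= ltxx mulr0n => /le_trans; apply.
  have -> : k0.+1%:R ^+ i * (0 + eta) = delta / 2 by rewrite /eta; field; rewrite gt_eqF.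
  by [].
have [x2 Hx2] : exists x, delta < u_ i m x.
  (* A level strictly above [delta], since a strict inequality is wanted. The initial tail equals 1
     at [-1], and [cascade_lower] keeps it above [d]. *)
  pose d : R := (1 + delta) / 2.
  have d01 : 0 < d < 1 by rewrite /d; lra.
  pose rho := Num.min 1 ((m0 - 1) / k0%:R).
  have rho0 : 0 < rho.
    by rewrite lt_min ltr01 divr_gt0 ?ltr0n// subr_gt0.
  have rho1 : rho <= 1 by rewrite ge_min lexx.
  have rhoE : rho <= (m0 - 1) / k0%:R by rewrite ge_min lexx orbT.
  have rd : rho * d <= 1 by have := mulr_gt0 rho0; nra.
  have e0 : 0 < rho * d * ((1 - d) * 2 / 2).
    by rewrite mulr_gt0 ?divr_gt0 ?mulr_gt0//; lra.
  have [B _ HB] := mu_tight e0.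
  exists (-1 - i%:R * B).
  have d01' : 0 < d <= 1 by lra.
  have ed : (1 - d) * 2 / 2 <= 1 - d by lra.
  have dd0 : 0 <= (1 - d) * 2 by lra.
  have d_1 : d <= u_ 0 (m + i) (-1) by rewrite /= ltrN10 mulr1n; lra.
  have [H _] := cascade_lower (ltW rho0) rhoE d01' ed rd dd0 (fun m => (HB m).1) d_1.
  by rewrite addn0 in H; apply: lt_le_trans H; rewrite /d; lra.
pose S := [set x | delta < u_ i m x].
have hS : has_sup S.
  split; first by exists x2.
  exists x1 => x /=; rewrite /S /= => dx; rewrite leNgt; apply/negP => x1x.
  by have := (tail_u i m).1 _ _ (ltW x1x); lra.
exists (sup S); split.
  rewrite leNgt; apply/negP => H; have : sup S + 1 <= sup S by apply: ub_le_sup => //; exact: hS.2.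
  by lra.
have [y Sy yS] := sup_adherent ltr01 hS.
apply: le_trans (ltW Sy) _; apply: (tail_u i m).1; exact: ltW.
Qed.

(** The quantile is taken [J] generations later, with [J] depending on [e] but not on [i]. On the
    way back to generation [m] the left tail becomes sharp; the right tail is made so small
    beforehand, by steepness, that the factor [(k0 + 1)^J] lost on the way does no harm. *)
Lemma cascade_concentrated e : 0 < e < 1 ->
  exists2 D : R, 0 <= D & forall i m, exists x,
    u_ i m (x + D) <= e /\ 1 - e <= u_ i m (x - D).
Proof.
move=> /andP[e0 e1].
have [eta [eps [C [eta0 eps0 C0 epsC HC]]]] := steep_constants M0 m0_gt1 a_gt0 k0_gt0.
have [B0 B00 HB0] := mu_tight eta0.
have [M Mpos stp] := HC B0.
have steepV i m : steep eps C M (u_ i m).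
  elim: i m => [|i IH] m; last first.
    by apply: stp (HB0 m).1 _ _ => //; exact: tail_u.
  (* For [z < 0] both tails are 1 and the inequality reads [1 + eps - C <= 1]. *)
  move=> z /=; case: (ltP z 0) => z0.
    by rewrite (_ : z - M < 0) /= ?expr1n; lra.
  by rewrite mulr0n expr0n !mulr0 subr0 ler0n.
pose delta := Num.min 2^-1 (eps / (2 * C)).
have delta0 : 0 < delta by rewrite lt_min invr_gt0 ltr0n divr_gt0// mulr_gt0.
have delta2 : delta <= 2^-1 by rewrite ge_min lexx.
have deltaC : delta <= eps / (2 * C) by rewrite ge_min lexx orbT.
pose rho := Num.min 1 ((m0 - 1) / k0%:R).
have rho0 : 0 < rho by rewrite lt_min ltr01 divr_gt0 ?ltr0n// subr_gt0.
have rho1 : rho <= 1 by rewrite ge_min lexx.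
have rhoE : rho <= (m0 - 1) / k0%:R by rewrite ge_min lexx orbT.
have rd0 : 0 < rho * delta by rewrite mulr_gt0.
have rd : rho * delta <= 2^-1 by have := ler_pM (ltW rho0) (ltW delta0) rho1 delta2; lra.
have [J HJ] : exists j, (1 - rho * delta) ^+ j <= e / 2.
  have g1 : `|1 - rho * delta| < 1 by rewrite ger0_norm; lra.
  have /cvgrPdist_le/(_ (e / 2)) := cvg_expr g1.
  case; first by rewrite divr_gt0.
  move=> N _ /(_ N (leqnn N)) /=; rewrite sub0r normrN => H.
  by exists N; apply: le_trans (ler_norm _) H.
pose X : R := k0.+1%:R ^+ J.
have X0 : 0 < X by rewrite exprn_gt0.
(* In [cascade_upper] the tail and the error, each at most [s], are multiplied by at most [X], and
   [2 X s = e]. *)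
pose s := e / (2 * X).
have s0 : 0 < s by rewrite divr_gt0// mulr_gt0.
have eta'0 : 0 < rho * delta * (e / 2) by rewrite mulr_gt0// divr_gt0.
have [B1 B10 HB1] := mu_tight eta'0.
have [B2 B20 HB2] := mu_tight s0.
have [Ds Ds0 HDs] := steep_decay eps0 C0 Mpos s0.
exists (1 + Ds + J%:R * B1 + J%:R * B2) => [|i m].
  by rewrite !addr_ge0// mulr_ge0// ltW.
(* If fewer than [J] generations remain, all of them are used, and the initial tail, which drops
   from 1 to 0 at the origin, replaces the quantile estimate. *)
pose j := minn J i.
have jJ : (j <= J)%N by exact: geq_minl.
have ji : (j <= i)%N by exact: geq_minr.
have jB (B : R) : 0 < B -> 0 <= j%:R * B <= J%:R * B.
  by move=> B_gt0; rewrite mulr_ge0 ?(ltW B_gt0)//= ler_wpM2r ?ler_nat// ltW.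
have JB (B : R) : 0 < B -> 0 <= J%:R * B by move=> B_gt0; rewrite mulr_ge0// ltW.
have kj : (k0.+1%:R : R) ^+ j <= X by rewrite ler_weXn2l// ler1n.
have [x [vs [vd vj]]] : exists x : R, u_ (i - j) (m + j) (x + (1 + Ds)) <= s /\
    (delta <= u_ (i - j) (m + j) (x - 1) /\
     (1 - rho * delta) ^+ j * (1 - u_ (i - j) (m + j) (x - 1)) <= e / 2).
  have [Ji|iJ] := leqP J i.
    have jE : j = J by exact/minn_idPl.
    have dd : 0 < delta < 1 by lra.
    have [x [x1 x2]] := cascade_quantile (i - j) (m + j) dd.
    exists x; split; first by rewrite addrA; apply: HDs (le_trans x1 deltaC); [exact: tail_u|].
    split => //; apply: le_trans HJ; rewrite jE in x2 *; rewrite ler_piMr//.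
      by rewrite exprn_ge0//; lra.
    by have := (tail_u (i - J) (m + J)).2 (x - 1); lra.
  have jE : j = i by exact/minn_idPr/ltnW.
  exists 0; rewrite jE subnn /=; split.
    by rewrite ltNge add0r addr_ge0//= ltW.
  rewrite sub0r ltrN10 mulr1n subrr mulr0; split; first lra.
  by rewrite divr_ge0// ltW.
have iE : i = (j + (i - j))%N by rewrite subnKC.
exists x; split.
  have up := cascade_upper (ltW s0) (fun m => (HB2 m).2) j (i - j) m (x + (1 + Ds)).
  rewrite -iE in up.
  apply: le_trans (le_trans _ up) _.
    by apply: (tail_u i m).1; have := jB _ B20; have := JB _ B10; lra.
  apply: (@le_trans _ _ (X * (s + s))).
    rewrite ler_pM ?exprn_ge0//; last by rewrite lerD2r.
    by rewrite addr_ge0 ?(ltW s0)//; case/andP: ((tail_u (i - j) (m + j)).2 (x + (1 + Ds))).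
  by rewrite /s le_eqVlt; apply/orP; left; apply/eqP; field; rewrite gt_eqF.
have de1 : 0 < delta <= 1 by lra.
have ed : e / 2 <= 1 - delta by lra.
have rd1 : rho * delta <= 1 by lra.
have lo := @cascade_lower rho delta e B1 (ltW rho0) rhoE de1 ed rd1 (ltW e0)
  (fun m => (HB1 m).1) j (i - j) m (x - 1) vd.
rewrite -iE in lo; case: lo => _ lo.
have : u_ i m (x - 1 - j%:R * B1) <= u_ i m (x - (1 + Ds + J%:R * B1 + J%:R * B2)).
  by apply: (tail_u i m).1; have := jB _ B10; have := JB _ B20; lra.
by lra.
Qed.

End cascade_concentration.

(** * From the branching random walk to the recursion *)

Section blocks.
Context d d' (T : measurableType d) (T' : measurableType d') (R : realType).
Context (P : probability T R) (I : choiceType) (X : I -> {RV P >-> T'}).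
Hypothesis X_indep : mutually_independent P X.
Implicit Types J : set I.

(** Finite-dimensional events in the coordinates from [J]: a pi-system generating the sigma-algebra
    of these coordinates. *)
Definition cylinder J : set (set T) := [set E | exists s A,
  [/\ uniq s, forall i, i \in s -> J i, forall i, measurable (A i) &
      E = \bigcap_(i in [set` s]) X i @^-1` A i]].

Lemma cylinder_preimage J i A : J i -> measurable A -> cylinder J (X i @^-1` A).
Proof.
move=> Ji mA; exists [:: i], (fun=> A); split => //.
  by move=> j; rewrite inE => /eqP->.
apply/seteqP; split => w /=; last by move=> /(_ i); apply; exact: mem_head.
by move=> Aw j /=; rewrite inE => /eqP->.
Qed.

Lemma cylinder_setT J : cylinder J setT.
Proof.
exists [::], (fun=> setT); split => //.
by apply/seteqP; split => // w _ i.
Qed.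

Lemma measurable_cylinder J : cylinder J `<=` measurable.
Proof.
move=> _ [s [A [_ _ mA ->]]]; apply: fin_bigcap_measurable => // i _.
rewrite -[X in measurable X]setTI.
exact: (measurable_funPT (X i)).
Qed.

Lemma cylinder_setI J : setI_closed (cylinder J).
Proof.
move=> _ _ [s [A [us sJ mA ->]]] [s' [A' [us' sJ' mA' ->]]].
exists (undup (s ++ s')), (fun i => (if i \in s then A i else setT) `&`
  (if i \in s' then A' i else setT)); split.
- exact: undup_uniq.
- by move=> i; rewrite mem_undup mem_cat => /orP[/sJ|/sJ'].
- by move=> i; apply: measurableI; case: ifP.
apply/seteqP; split => w /=.
  move=> [H H'] i _; split; case: ifP => // si; [exact: H|exact: H'].
move=> H; split => i /= si; have := H i; rewrite /= mem_undup mem_cat si ?orbT => /(_ isT)[].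
  by [].
by [].
Qed.

Lemma cylinder_independent J J' E E' : J `&` J' = set0 ->
  cylinder J E -> cylinder J' E' -> P (E `&` E') = (P E * P E')%E.
Proof.
move=> JJ' [s [A [us sJ mA ->]]] [s' [A' [us' sJ' mA' ->]]].
have dis i : i \in s -> i \in s' -> False.
  by move=> /sJ Ji /sJ' J'i; have : (J `&` J') i by []; rewrite JJ'.
pose B i := if i \in s then A i else A' i.
have mB i : measurable (B i) by rewrite /B; case: ifP.
have Bs i : i \in s -> B i = A i by rewrite /B => ->.
have Bs' i : i \in s' -> B i = A' i.
  by move=> is'; rewrite /B; case: ifP => // /dis/(_ is').
have -> : (\bigcap_(i in [set` s]) X i @^-1` A i) `&`
    (\bigcap_(i in [set` s']) X i @^-1` A' i) =
    \bigcap_(i in [set` s ++ s']) X i @^-1` B i.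
  apply/seteqP; split => w /=.
    move=> [H H'] i /=; rewrite mem_cat => /orP[si|si].
      by rewrite Bs//; exact: H.
    by rewrite Bs'//; exact: H'.
  move=> H; split => i /= si; have := H i; rewrite /= mem_cat si ?orbT => /(_ isT).
    by rewrite Bs.
  by rewrite Bs'.
rewrite !X_indep//; last first.
  rewrite cat_uniq us us' andbT /=; apply/hasPn => i /= is'; apply/negP => si.
  exact: (dis i).
rewrite big_cat/=; congr (_ * _)%E; rewrite !big_seq; apply: eq_bigr => i si.
  by rewrite Bs.
by rewrite Bs'.
Qed.

(** Both sides are finite measures in [F] that agree on a pi-system containing [setT], hence on the
    sigma-algebra generated by it. *)
Lemma product_rule_gen (G : set (set T)) (E : set T) : measurable E ->
  G `<=` measurable -> setI_closed G -> G setT ->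
  (forall F, G F -> P (F `&` E) = (P F * P E)%E) ->
  forall F, <<s G >> F -> P (F `&` E) = (P F * P E)%E.
Proof.
move=> mE Gm GI GT H F sGF.
have PE0 : 0 <= fine (P E) by apply: fine_ge0.
pose m1 := mrestr P mE; pose m2 := mscale (NngNum PE0) P.
have m2E A : m2 A = (P A * P E)%E.
  by rewrite /m2 /mscale /= fineK ?fin_num_measure// muleC.
have : m1 F = m2 F; last by rewrite m2E.
apply: (@g_sigma_algebra_measure_unique _ _ _ G Gm (fun=> setT)) => //.
- by rewrite bigcup_const//; exists 0%N.
- by move=> A GA; rewrite [RHS]m2E -H.
- by move=> _; rewrite /= /mrestr setTI ltey_eq fin_num_measure.
Qed.

(** The product rule is extended from cylinders to the generated sigma-algebras in one argument at a
    time. *)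
Lemma block_independent J J' E E' : J `&` J' = set0 ->
  <<s cylinder J >> E -> <<s cylinder J' >> E' -> P (E `&` E') = (P E * P E')%E.
Proof.
move=> JJ' sE sE'.
have gen_meas K F : <<s cylinder K >> F -> measurable F.
  by apply: smallest_sub; [exact: sigma_algebra_measurable|exact: measurable_cylinder].
have mE' := gen_meas _ _ sE'.
apply: (product_rule_gen mE' (@measurable_cylinder J) (@cylinder_setI J) (cylinder_setT J)) sE.
move=> F cF; have mF := measurable_cylinder cF.
rewrite setIC muleC.
apply: (product_rule_gen mF (@measurable_cylinder J') (@cylinder_setI J') (cylinder_setT J')) sE'.
by move=> F' cF'; rewrite setIC muleC; exact: cylinder_independent cF cF'.
Qed.

End blocks.

(** * Maxima over subtrees *)

Section subtree_maximum.
Context (R : realType) (T : Type) (W : particle -> T -> ragged R).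

(* Largest displacement, relative to r, of the descendants of r after i
   generations. *)
Fixpoint sub_max (i : nat) (r : particle) (w : T) : R :=
  if i is i'.+1 then
    \big[Num.max/nth 0 (W r w) 0 + sub_max i' (0%N :: r) w]_(j < size (W r w))
      (nth 0 (W r w) j + sub_max i' (nat_of_ord j :: r) w)
  else 0.

(** The default value of the iterated maximum is the term of child 0, which is one of the terms as
    soon as the brood is nonempty. *)
Lemma sub_max_leP i r w x : (0 < size (W r w))%N ->
  sub_max i.+1 r w <= x <->
  forall j, (j < size (W r w))%N -> nth 0 (W r w) j + sub_max i (j :: r) w <= x.
Proof.
move=> W0; split=> /= [/bigmax_leP[_ H] j jW|H].
  exact: (H (Ordinal jW) isT).
by apply/bigmax_leP; split=> [|j _]; exact: H.
Qed.

End subtree_maximum.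

Definition descendants (r : particle) : set particle := [set v | exists s, v = s ++ r].

Lemma descendants_cons j r : descendants (j :: r) `<=` descendants r.
Proof. by move=> _ [s ->]; exists (rcons s j); rewrite cat_rcons. Qed.

Lemma descendants_cons_disjoint i j r v :
  descendants (i :: r) v -> descendants (j :: r) v -> i = j.
Proof.
move=> [s ->] [s' /eqP].
have [ss|ss] := eqVneq (size s) (size s').
  by rewrite eqseq_cat// eqseq_cons => /andP[_ /andP[/eqP]].
by move/eqP/(congr1 size); rewrite !size_cat /= => /addIn/eqP; rewrite (negPf ss).
Qed.

Lemma descendants_consN j r : ~ descendants (j :: r) r.
Proof.
by move=> [s /(congr1 size)/eqP]; rewrite size_cat/= addnS -addSn -[X in X == _]add0n eqn_add2r.
Qed.

(** The sigma-algebra on the sample space is left arbitrary: applied to the one generated by the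
    offspring vectors of the descendants of [r], this places the subtree maximum in the right block
    for independence. *)
Lemma measurable_sub_max (R : realType) d (T : measurableType d)
    (W : particle -> T -> ragged R) i r :
  (forall v, descendants r v -> measurable_fun setT (W v)) ->
  measurable_fun setT (sub_max W i r).
Proof.
elim: i r => [|i IH] r mW /=; first exact: measurable_cst.
have mr : measurable_fun setT (W r) by apply: mW; exists [::].
have mf j : measurable_fun setT (fun w => nth 0 (W r w) j + sub_max W i (j :: r) w).
  apply: measurable_funD.
    exact: (measurableT_comp (@measurable_ragged_nth R j) mr).
  by apply: IH => v /descendants_cons; exact: mW.
apply: (measurability (@RGenOInfty.G R)) => [|/= _ [_] [x] -> <-].
  exact: RGenOInfty.measurableE.
have m_gt (f : T -> R) : measurable_fun setT f -> measurable [set w | x < f w].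
  move=> mf'; have := mf' measurableT _ (measurable_itv `]x, +oo[).
  rewrite setTI; congr measurable; apply/seteqP; split => w /=; rewrite in_itv/= andbT//.
rewrite setTI [X in measurable X](_ : _ =
    [set w | x < nth 0 (W r w) 0 + sub_max W i (0%N :: r) w] `|`
    \bigcup_j ([set w | (j < size (W r w))%N] `&`
      [set w | x < nth 0 (W r w) j + sub_max W i (j :: r) w])).
  apply: measurableU; first exact: m_gt.
  apply: bigcupT_measurable => j; apply: measurableI; last exact: m_gt.
  have := mr measurableT _ (measurable_ragged_size (fun k => (j < k)%N)).
  by rewrite setTI.
apply/seteqP; split => w /=; rewrite in_itv/= andbT.
  move=> xm; apply: contrapT => /not_orP[/negP n0 nj].
  move: xm; rewrite ltNge => /negP; apply; apply/bigmax_leP; split.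
    by rewrite leNgt.
  move=> j _; rewrite leNgt; apply/negP => xj.
  by apply: nj; exists (nat_of_ord j) => //; split => /=.
case=> [x0|[j _ [/= jW xj]]].
  by apply: lt_le_trans x0 _; exact: bigmax_ge_id.
by apply: lt_le_trans xj _; exact: (@le_bigmax_cond _ _ _ _ (Ordinal jW) xpredT).
Qed.

(** * The maximal position as a maximum over independent subtrees *)

Section gbrw_recursion.
Context d (T : measurableType d) (R : realType) (P : probability T R).
Context (p : nat -> nat -> R) (G : forall n k : nat, probability (k.-tuple R) R).
Variable Z : gbrw P p G.
Local Notation maxZ := (sub_max (fun v w => Z v w)).

(** A label carries its youngest generation at the head, while [sub_max] unfolds from the oldest
    one; the induction therefore splits off the last entry of [v]. *)
Lemma max_position_le_sub_max i r w x : born Z r w ->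
  maxZ i r w <= x <->
  (forall v, size v = i -> born Z (v ++ r) w ->
     position Z (v ++ r) w <= x + position Z r w).
Proof.
elim: i r x => [|i IH] r x br.
  split=> [x0 v /size0nil -> _ /=|/(_ [::] erefl br)/=].
    by rewrite lerDr.
  by rewrite lerDr.
rewrite sub_max_leP; last exact: offspring_gt0.
split=> [H v|H j jr].
  case/lastP: v => [//|v j]; rewrite size_rcons cat_rcons => -[sv] bv.
  have bjr : born Z (j :: r) w.
    by elim: v bv {sv} => [//|a v IHv] /= /andP[/IHv].
  have jr : (j < size (Z r w))%N by move: bjr => /= /andP[].
  have := H j jr; rewrite addrC -lerBrDr => /(IH _ _ bjr)/(_ v sv bv)/=.
  by lra.
have bjr : born Z (j :: r) w by rewrite /= br jr.
rewrite addrC -lerBrDr; apply/(IH _ _ bjr) => v sv bv.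
have := H (rcons v j); rewrite size_rcons sv cat_rcons => /(_ erefl bv)/=.
by lra.
Qed.

Lemma max_position_sub_max n w x :
  max_position Z n w <= x <-> maxZ n [::] w <= x.
Proof.
have [[v av vE] vmax] := max_positionP Z n w.
rewrite max_position_le_sub_max//=; split=> [mx u su bu|H].
  rewrite cats0 in bu *; rewrite addr0; apply: le_trans mx; apply: vmax.
  by split.
rewrite -vE; case: av => sv bv; have := H v sv; rewrite cats0 addr0; exact.
Qed.

Let gen J := g_sigma_algebraType (cylinder Z J).

Let measurable_gen (J : set particle) v : J v ->
  measurable_fun setT (Z v : gen J -> ragged R).
Proof.
move=> Jv _ A mA; rewrite setTI; apply: sub_sigma_algebra.
exact: cylinder_preimage.
Qed.

Let sub_max_gen (J : set particle) i r x : descendants r `<=` J ->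
  <<s cylinder Z J >> [set w | maxZ i r w <= x].
Proof.
move=> rJ.
have := @measurable_sub_max R _ (gen J) (fun v w => Z v w) i r
  (fun v rv => measurable_gen (rJ _ rv)) measurableT _ (measurable_itv `]-oo, x]).
by rewrite setTI; congr (_ _); apply/seteqP; split => w /=; rewrite in_itv.
Qed.

Lemma sub_max_measurable i r : measurable_fun setT (maxZ i r).
Proof. by apply: measurable_sub_max => v _; exact: measurable_funPT. Qed.

Lemma measurable_sub_max_le i r x : measurable [set w | maxZ i r w <= x].
Proof.
have := @sub_max_measurable i r measurableT _ (measurable_itv `]-oo, x]).
by rewrite setTI; congr measurable; apply/seteqP; split => w /=; rewrite in_itv.
Qed.

(** Distinct children have disjoint sets of descendants; they are added one at a time, each being
    independent of the block of its predecessors. *)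
Lemma sub_max_independent i r n (t : nat -> R) :
  P [set w | forall j, (j < n)%N -> maxZ i (j :: r) w <= t j] =
  (\prod_(j < n) P [set w | (maxZ i (nat_of_ord j :: r) w <= t j)%R])%E.
Proof.
elim: n => [|n IH].
  rewrite big_ord0 [X in P X](_ : _ = setT) ?probability_setT//.
  by apply/seteqP; split.
rewrite big_ord_recr/= -IH.
pose J := [set v | exists2 j, (j < n)%N & descendants (j :: r) v].
have JJ : J `&` descendants (n :: r) = set0.
  apply/seteqP; split => // v [[j jn jv] nv].
  by move: jn; rewrite (descendants_cons_disjoint jv nv) ltnn.
rewrite -(block_independent (@offspring_independent _ _ _ _ _ _ Z) JJ).
- congr (P _); apply/seteqP; split => w /=.
    by move=> H; split => [j jn|]; apply: H => //; exact: ltnW.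
  by move=> [H H'] j; rewrite ltnS leq_eqVlt => /orP[/eqP->//|/H].
- rewrite [X in <<s _ >> X](_ : _ =
      \bigcap_(j in [set j | (j < n)%N]) [set w | maxZ i (j :: r) w <= t j]).
    apply: (@fin_bigcap_measurable _ (gen J)); first exact: finite_II.
    move=> j /= jn; apply: sub_max_gen => v jv; by exists j.
  by apply/seteqP; split.
- exact: sub_max_gen.
Qed.

End gbrw_recursion.

(** * First-step decomposition *)

Section gbrw_step.
Context d (T : measurableType d) (R : realType) (P : probability T R).
Context (p : nat -> nat -> R) (G : forall n k : nat, probability (k.-tuple R) R).
Variables (Z : gbrw P p G) (k0 : nat).
Local Notation maxZ := (sub_max (fun v w => Z v w)).

Definition progeny (v : particle) : probability (ragged R) R := distribution P (Z v).

Lemma sub_max_branch i r x (q : R -> R) : tail_function q ->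
  progeny r (brood k0) = 1%E ->
  (forall j y, P [set w | maxZ i (j :: r) w <= y] = (1 - q y)%:E) ->
  P [set w | maxZ i.+1 r w <= x] = (1 - branch k0 (progeny r) q x)%:E.
Proof.
(* [W] has [k0] entries whatever the brood, since subtree maxima are defined for unborn labels as
   well. Thus it depends on the offspring vectors of proper descendants of [r] only. *)
move=> qt broodr qE.
pose W w : k0.-tuple R := [tuple maxZ i (nat_of_ord j :: r) w | j < k0].
have mWJ : measurable_fun setT
    (W : g_sigma_algebraType (cylinder Z [set v | exists j, descendants (j :: r) v]) -> _).
  apply/measurable_fun_tnthP => j.
  rewrite [X in measurable_fun _ X](_ : _ = maxZ i (nat_of_ord j :: r)).
    apply: measurable_sub_max => v jv _ A mA; rewrite setTI.
    by apply: sub_sigma_algebra; apply: cylinder_preimage => //; exists j.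
  by apply/funext => w /=; rewrite tnth_mktuple.
have mW : measurable_fun setT W.
  apply/measurable_fun_tnthP => j.
  rewrite [X in measurable_fun _ X](_ : _ = maxZ i (nat_of_ord j :: r)).
    exact: sub_max_measurable.
  by apply/funext => w /=; rewrite tnth_mktuple.
pose X w : (ragged R * k0.-tuple R)%type := (Z r w, W w).
have mX : measurable_fun setT X by apply: measurable_fun_pair => //; exact: measurable_funPT.
pose Xm : {mfun T >-> (ragged R * k0.-tuple R)%type} :=
  HB.pack X (@isMeasurableFun.Build _ _ _ _ X mX).
pose Wm : {mfun T >-> k0.-tuple R} := HB.pack W (@isMeasurableFun.Build _ _ _ _ W mW).
pose nu : probability (k0.-tuple R) R := distribution P Wm.
have joint A B : measurable A -> measurable B ->
    distribution P Xm (A `*` B) = (progeny r A * nu B)%E.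
  move=> mA mB.
  have JJ : [set r] `&` [set v | exists j, descendants (j :: r) v] = set0.
    by apply/seteqP; split => // v [/= -> [j /descendants_consN]].
  apply: (block_independent (@offspring_independent _ _ _ _ _ _ Z) JJ).
    by apply: sub_sigma_algebra; exact: cylinder_preimage.
  by have := mWJ measurableT B mB; rewrite setTI.
pose C : set (ragged R * k0.-tuple R) := [set u | brood k0 u.1 /\
  forall j : 'I_k0, (j < size u.1)%N -> nth 0 u.1 j + tnth u.2 j <= x].
have mC : measurable C.
  have m1 (B : set nat) : measurable [set u : ragged R * k0.-tuple R | B (size u.1)].
    have := @measurable_fst _ _ (ragged R) (k0.-tuple R) measurableT _
      (@measurable_ragged_size R B).
    by rewrite setTI.
  rewrite (_ : C = [set u | brood k0 u.1] `&` \bigcap_(j in [set: 'I_k0])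
      ([set u | ~ (j < size u.1)%N] `|` [set u | nth 0 u.1 j + tnth u.2 j <= x])).
    apply: measurableI; first exact: (m1 (fun k => (0 < k <= k0)%N)).
    apply: fin_bigcap_measurable; first exact: finite_finset.
    move=> j _; apply: measurableU; first exact: (m1 (fun k => ~ (j < k)%N)).
    have mf : measurable_fun setT (fun u : ragged R * k0.-tuple R => nth 0 u.1 j + tnth u.2 j).
      apply: measurable_funD.
        exact: (measurableT_comp (@measurable_ragged_nth R j) measurable_fst).
      exact: (measurableT_comp (measurable_tnth j) measurable_snd).
    have := mf measurableT _ (measurable_itv `]-oo, x]).
    by rewrite setTI; congr measurable; apply/seteqP; split => u /=; rewrite in_itv.
  apply/seteqP; split => u /= [bu H]; split => // j.
    by move=> _; have [ju|nju] := boolP (j < size u.1)%N; [right; exact: H|left; exact/negP].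
  by move=> ju; have [] := H j I.
have mb := @measurable_brood R k0.
have mbZ : measurable [set w | brood k0 (Z r w)].
  by rewrite -[X in measurable X]setTI; exact: (measurable_funPT (Z r)).
have -> : P [set w | maxZ i.+1 r w <= x] = distribution P Xm C.
  rewrite -(probability_setI_full (measurable_sub_max_le Z i.+1 r x) mbZ broodr).
  congr (P _); apply/seteqP; split => w /=.
    move=> [H bw]; split => // j jw; rewrite tnth_mktuple.
    by move/sub_max_leP : H; apply => //; case/andP: bw.
  move=> [bw H]; split => //; apply/sub_max_leP; first by case/andP: bw.
  move=> j jw; have jk : (j < k0)%N by apply: leq_trans jw _; case/andP: bw.
  by have := H (Ordinal jk) jw; rewrite tnth_mktuple.
have section xi : brood k0 xi -> nu (xsection C xi) = (\prod_(y <- xi) (1 - q (x - y)))%:E.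
  move=> bxi; have /andP[_ xik] := bxi.
  have -> : nu (xsection C xi) = P [set w | forall j, (j < size xi)%N ->
      maxZ i (j :: r) w <= x - nth 0 xi j].
    congr (P _); apply/seteqP; split => w /=; rewrite /xsection /= inE /=.
      move=> [_ H] j jxi; have jk := leq_trans jxi xik.
      by have := H (Ordinal jk) jxi; rewrite /= tnth_mktuple lerBrDl.
    by move=> H; split => // j jxi; rewrite tnth_mktuple -lerBrDl; exact: H.
  rewrite sub_max_independent (big_nth 0) big_mkord -prodEFin.
  by apply: eq_bigr => j _; rewrite qE.
rewrite -(product_measure_unique (m1 := progeny r) (m2 := nu) joint)//.
have E : ((progeny r \x nu) C =
    \int[progeny r]_(xi in brood k0) (\prod_(y <- xi) (1 - q (x - y)))%:E)%E.
  rewrite integral_mkcond; apply: eq_integral => xi _ /=.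
  rewrite patchE; case: ifPn => [|/negP nb].
    by rewrite inE => /section.
  rewrite (_ : xsection C xi = set0) ?measure0//.
  by apply/seteqP; split => // y; rewrite /xsection /= inE /= => -[bxi _]; apply: nb; rewrite inE.
have f : ((progeny r \x nu) C \is a fin_num)%E.
  by rewrite (product_measure_unique (m1 := progeny r) (m2 := nu) joint)// fin_num_measure.
by rewrite /branch opprB addrC subrK -(fineK f) E.
Qed.

End gbrw_step.

Lemma measurable_all_tuple (R : realType) (b : R -> bool) k : measurable_fun setT b ->
  measurable [set x : k.-tuple R | forall i, b (tnth x i)].
Proof.
move=> mb.
rewrite [X in measurable X](_ : _ = \bigcap_(i in [set: 'I_k]) [set x | b (tnth x i)]).
  apply: fin_bigcap_measurable; first exact: finite_finset.
  move=> i _; have mbi := measurableT_comp mb (@measurable_tnth _ R k i).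
  have mt : measurable [set true] by [].
  by have := mbi measurableT _ mt; rewrite setTI.
by apply/seteqP; split => x /= H i; [move=> _|]; exact: (H i).
Qed.

(** * Laws of the offspring vectors and of the maximum *)

Section progeny_law.
Context d (T : measurableType d) (R : realType) (P : probability T R).
Context (p : nat -> nat -> R) (G : forall n k : nat, probability (k.-tuple R) R).
Variable Z : gbrw P p G.
Local Notation maxZ := (sub_max (fun v w => Z v w)).

Definition sized k (A : set (k.-tuple R)) : set (ragged R) :=
  [set xi | exists2 x, A x & xi = tval x].

Lemma measurable_sized k (A : set (k.-tuple R)) : measurable A -> measurable (sized A).
Proof.
move=> mA; change (ragged_measurable (sized A)) => l.
have [lk|lk] := eqVneq l k.
  move: A mA; rewrite -lk => A mA.
  rewrite [X in measurable X](_ : _ = A)//; apply/seteqP; split=> x /=.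
    by move=> [y Ay /val_inj ->].
  by exists x.
rewrite [X in measurable X](_ : _ = set0)//; apply/seteqP; split=> // x [y _] /(congr1 size).
by rewrite !size_tuple => /eqP; rewrite (negPf lk).
Qed.

Lemma progeny_sized v k (A : set (k.-tuple R)) : (0 < k)%N -> measurable A ->
  progeny Z v (sized A) = ((p (size v) k)%:E * G (size v) k A)%E.
Proof.
by move=> k0 mA; rewrite -(offspring_size Z v k0) -(offspring_displacement Z v k0 mA).
Qed.


Lemma progeny_bigcup v (A : set (ragged R)) : measurable A ->
  progeny Z v A = (\sum_(k <oo) progeny Z v (sized [set x : k.-tuple R | A (tval x)]))%E.
Proof.
move=> mA.
have AE : A = \bigcup_k sized [set x : k.-tuple R | A (tval x)].
  apply/seteqP; split => xi.
    by move=> Axi; exists (size xi) => //; exists (in_tuple xi).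
  by move=> [k _ [x Ax ->]].
rewrite [in LHS]AE measure_bigcup => [|k _|].
- by apply: eq_eseriesl => k; rewrite in_setT.
- by apply: measurable_sized; exact: (mA k).
apply/trivIsetP => k l _ _ kl; apply/seteqP; split => // xi [[x _ ->] [y _]] /(congr1 size).
by rewrite !size_tuple => /eqP; rewrite (negPf kl).
Qed.

Lemma progeny_sized0 v (A : set (0.-tuple R)) : progeny Z v (sized A) = 0%E.
Proof.
rewrite /progeny /= /distribution /pushforward [X in P X](_ : _ = set0) ?measure0//.
apply/seteqP; split => // w [x _ Zx].
by have := offspring_gt0 Z v w; rewrite Zx size_tuple.
Qed.

(** The law is determined by its traces on the spaces [R^k], where [p] and [G] see the generation of
    the label and nothing else. *)
Lemma progeny_size_eq v v' (A : set (ragged R)) : size v = size v' ->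
  measurable A -> progeny Z v A = progeny Z v' A.
Proof.
move=> vv' mA; rewrite !progeny_bigcup//; apply: eq_eseriesr => -[_|k _].
  by rewrite !progeny_sized0.
by rewrite !progeny_sized// ?vv'//; exact: (mA k.+1).
Qed.

Section bounded_offspring.
Variable k0 : nat.
Hypothesis B1 : forall n k : nat, ~~ (1 <= k <= k0)%N -> p n k = 0.

Lemma progeny_brood v : progeny Z v (brood k0) = 1%E.
Proof.
have mb := @measurable_brood R k0.
have bC : progeny Z v (~` brood k0) = 0%E.
  rewrite progeny_bigcup; last exact: measurableC.
  apply: eseries0 => -[_ _|k _ _]; first exact: progeny_sized0.
  rewrite progeny_sized//; last exact: (measurableC mb k.+1).
  have [kk|kk] := boolP (1 <= k.+1 <= k0)%N; last by rewrite B1// mul0e.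
  rewrite (_ : [set x | _] = set0) ?measure0 ?mule0//.
  by apply/seteqP; split => // x /=; rewrite /brood /= size_tuple; apply.
have := @probability_setC _ _ _ (progeny Z v) _ (measurableC mb).
by rewrite setCK bC sube0.
Qed.

Lemma expect_sized v k (A : set (k.-tuple R)) : (0 < k)%N -> measurable A ->
  expect k0 (progeny Z v) (\1_(sized A)) = p (size v) k * fine (G (size v) k A).
Proof.
move=> k1 mA; have mS := measurable_sized mA.
have := expect_indic (progeny_brood v) mS; rewrite progeny_sized// => E.
have : ((expect k0 (progeny Z v) (\1_(sized A)))%:E =
    (p (size v) k * fine (G (size v) k A))%:E)%E.
  by rewrite E EFinM fineK// fin_num_measure.
by case.
Qed.

Lemma expect_split v (f : ragged R -> R) : observable k0 f ->
  expect k0 (progeny Z v) f = \sum_(1 <= k < k0.+1)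
    expect k0 (progeny Z v) (fun xi => (size xi == k)%:R * f xi).
Proof.
move=> of_; have mub := progeny_brood v.
have ok k : observable k0 (fun xi => (size xi == k)%:R * f xi).
  have [[m1 _] [m2 [c fc]]] := (observable_size k0 (fun l => (l == k)%:R : R), of_).
  split; first exact: measurable_funM.
  exists c => xi /fc fxi; rewrite normrM; apply: le_trans fxi.
  by rewrite ler_piMl// ger0_norm// lern1 leq_b1.
rewrite -(expect_bigsum mub)//.
have obs := observable_bigsum (index_iota 1 k0.+1) ok.
have E xi : brood k0 xi -> \sum_(1 <= k < k0.+1) (size xi == k)%:R * f xi = f xi.
  move=> bxi; rewrite -big_distrl/= (bigD1_seq (size xi)) ?iota_uniq ?mem_index_iota//=.
  by rewrite eqxx big1 ?addr0 ?mul1r// => k; rewrite eq_sym => /negPf->.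
by apply/eqP; rewrite eq_le; apply/andP; split; apply: le_expect => // xi /E->.
Qed.

Lemma expect_size_mean v :
  expect k0 (progeny Z v) (fun xi => (size xi)%:R) = \sum_(1 <= k < k0.+1) k%:R * p (size v) k.
Proof.
rewrite expect_split; last exact: (observable_size k0 (fun k => k%:R)).
apply: eq_big_nat => k /andP[k1 _].
have -> : (fun xi : ragged R => (size xi == k)%:R * (size xi)%:R) =
    (fun xi => k%:R * \1_(sized [set: k.-tuple R]) xi : R).
  apply/funext => xi; rewrite indicE; case: eqP => [xik|xik].
    rewrite xik mul1r mem_set ?mulr1//.
    by subst k; exists (in_tuple xi).
  by rewrite mul0r memNset ?mulr0// => -[x _ xE]; apply: xik; rewrite xE size_tuple.
have mT : measurable [set: k.-tuple R] by [].
rewrite (expectZ (progeny_brood v)); last by apply: observable_indic; exact: measurable_sized.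
by rewrite expect_sized// probability_setT mulr1.
Qed.

Lemma expect_all v (b : R -> bool) : measurable_fun setT b ->
  expect k0 (progeny Z v) (fun xi => (all b xi)%:R) = \sum_(1 <= k < k0.+1)
    p (size v) k * fine (G (size v) k [set x | forall i, b (tnth x i)]).
Proof.
move=> mb; rewrite expect_split; last exact: observable_all.
apply: eq_big_nat => k /andP[k1 _].
have mA := @measurable_all_tuple R b k mb.
rewrite -expect_sized//; congr expect; apply/funext => xi; rewrite indicE.
case: eqP => [xik|xik]; last first.
  by rewrite mul0r memNset// => -[x _ xE]; apply: xik; rewrite xE size_tuple.
rewrite mul1r; subst k; congr (nat_of_bool _)%:R; apply/idP/idP => [/all_nthP H|].
  rewrite inE; exists (in_tuple xi) => //= i.
  by rewrite (tnth_nth 0); apply: H.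
rewrite inE => -[x bx xE]; apply/(all_nthP 0) => i ik.
by rewrite xE -(tnth_nth 0 x (Ordinal ik)).
Qed.

Lemma intensity_tail v (z : R) :
  intensity k0 (progeny Z v) (fun y => (z < y)%R%:R) = \sum_(1 <= k < k0.+1)
    p (size v) k * \sum_(i < k) fine (G (size v) k [set x | z < tnth x i]).
Proof.
rewrite /intensity expect_split; last by apply: observable_sum; exact: bounded_meas_tail.
apply: eq_big_nat => k /andP[k1 _].
have mA i : measurable [set x : k.-tuple R | z < tnth x i].
  have := @measurable_tnth _ R k i measurableT _ (measurable_itv `]z, +oo[).
  by rewrite setTI; congr measurable; apply/seteqP; split => x /=; rewrite in_itv/= andbT.
have -> : (fun xi : ragged R => (size xi == k)%:R * \sum_(y <- xi) (z < y)%R%:R) =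
    (fun xi => \sum_(i < k) \1_(sized [set x : k.-tuple R | z < tnth x i]) xi : R).
  apply/funext => xi; case: eqP => [xik|xik]; last first.
    rewrite mul0r big1// => i _; rewrite indicE memNset//.
    by move=> [x _ xE]; apply: xik; rewrite xE size_tuple.
  rewrite mul1r; subst k; rewrite (big_nth 0) big_mkord; apply: eq_bigr => i _.
  rewrite indicE; congr (nat_of_bool _)%:R; apply/idP/idP => [zx|].
    by rewrite inE; exists (in_tuple xi) => //=; rewrite (tnth_nth 0).
  by rewrite inE => -[x /= + xE]; rewrite (tnth_nth 0) -xE.
rewrite (expect_bigsum (progeny_brood v)); last first.
  by move=> i; apply: observable_indic; exact: measurable_sized.
by rewrite big_distrr/=; apply: eq_bigr => i _; rewrite expect_sized.
Qed.

(** Generation [m] is represented by the label [nseq m 0], as offspring laws agree within a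
    generation. A label [r] belongs to generation [size r], and its children to the next one, as in
    the recursion of [cascade]. *)
Lemma max_cascade i r x : P [set w | maxZ i r w <= x] =
  (1 - cascade k0 (fun m => progeny Z (nseq m 0%N)) i (size r) x)%:E.
Proof.
set mu := fun m => progeny Z (nseq m 0%N).
have mub m : mu m (brood k0) = 1%E by exact: progeny_brood.
elim: i r x => [|i IH] r x.
  rewrite /=; case: (ltP x 0) => x0.
    rewrite mulr1n subrr [X in P X](_ : _ = set0) ?measure0//.
    by apply/seteqP; split => // w /=.
  rewrite mulr0n subr0 [X in P X](_ : _ = setT) ?probability_setT//.
  by apply/seteqP; split.
rewrite (sub_max_branch x (tail_cascade mub i (size r).+1) (progeny_brood r)); last first.
  by move=> j y; exact: IH.
rewrite /= /branch; congr (1 - (1 - fine _))%:E.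
by apply: eq_measure_integral => A mA _; apply: progeny_size_eq => //; rewrite size_nseq.
Qed.

End bounded_offspring.
End progeny_law.

(** * Tightness of the recentred maximum *)

Theorem theorem1 (R : realType) (d : measure_display) (T : measurableType d)
    (P : probability T R)
    (p : nat -> nat -> R)
    (p_ge0 : forall n k : nat, (0 < k)%N -> 0 <= p n k)
    (p_sum1 : forall n : nat, (\sum_(1 <= k <oo) (p n k)%:E = 1)%E)
    (p_mean : forall n : nat, (\sum_(1 <= k <oo) (k%:R * p n k)%:E < +oo)%E)
    (G : forall n k : nat, probability (k.-tuple R) R)
    (g : nat -> nat -> R -> R)
    (G_marginal : forall (n k : nat) (i : 'I_k) (x : R),
      G n k [set y | tnth y i <= x] = (g n k x)%:E)
    (gbar : nat -> nat -> R -> R)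
    (gbarE : forall (n k : nat) (x : R), gbar n k x = 1 - g n k x)
    (Z : gbrw P p G)
    (k0 : nat) (k0_gt1 : (1 < k0)%N)
    (B1 : forall n k : nat, ~~ (1 <= k <= k0)%N -> p n k = 0)
    (m0 : R) (m0_gt1 : 1 < m0)
    (B2 : m0 < inf (range (fun n : nat => \sum_(1 <= k < k0.+1) k%:R * p n k)))
    (eps0 : R) (eps0_lt : eps0 < Num.min (4^-1 * ln m0) 1)
    (MT1 : exists x0 : R, forall n k : nat, p n k != 0 ->
      1 - eps0 <= gbar n k x0)
    (MT2 : exists a M0 : R, [/\ 0 < a, 0 < M0 &
      forall n k : nat, p n k != 0 -> forall M x : R, M0 < M -> 0 <= x ->
        gbar n k (x + M) <= expR (- (a * M)) * gbar n k x])
    (GT : forall eta1 : R, 0 < eta1 -> exists2 B : R, 0 < B &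
      forall n k : nat, p n k != 0 ->
        ((1 - eta1)%:E <= joint_cdf (G n k) (fun=> B))%E /\
        ((1 - eta1)%:E <= G n k [set y | forall i, (- B <= tnth y i)%R])%E) :
  tight (fun n : nat => distribution P (recentred P (max_position Z n))).
Proof.
have k0_gt0 : (0 < k0)%N by exact: ltnW.
have m_le n : m0 <= \sum_(1 <= k < k0.+1) k%:R * p n k.
  apply: (le_trans (ltW B2)); apply: ge_inf; last by exists n.
  exists 0 => _ [l _ <-]; rewrite big_nat sumr_ge0// => k /andP[k1 _].
  by rewrite mulr_ge0// p_ge0.
have G_tail n k (i : 'I_k) z : fine (G n k [set x | z < tnth x i]) = gbar n k z.
  have mA : measurable [set x : k.-tuple R | tnth x i <= z].
    have := @measurable_tnth _ R k i measurableT _ (measurable_itv `]-oo, z]).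
    by rewrite setTI; congr measurable; apply/seteqP; split => x /=; rewrite in_itv.
  rewrite (_ : [set x | z < tnth x i] = ~` [set x | tnth x i <= z]); last first.
    by apply/seteqP; split => x /=; rewrite real_ltNge ?num_real// => /negP.
  by rewrite probability_setC// G_marginal gbarE.
pose mu m := progeny Z (nseq m 0%N).
have [a [M0 [a_gt0 _ tail]]] := MT2.
have mu_reg m : regular_law k0 m0 a M0 (mu m).
  split => [||M z MM z0].
  - exact: progeny_brood.
  - by rewrite expect_size_mean// size_nseq.
  rewrite !intensity_tail// size_nseq big_distrr/= !big_nat.
  apply: ler_sum => k /andP[k1 _].
  have [->|pk] := eqVneq (p m k) 0; first by rewrite !mul0r mulr0.
  rewrite mulrCA ler_wpM2l ?p_ge0// big_distrr; apply: ler_sum => i _ /=.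
  by rewrite !G_tail; exact: tail.
have p_sum n : \sum_(1 <= k < k0.+1) p n k = 1.
  have := expect_all Z B1 (nseq n 0%N) (b := xpredT) (measurable_cst _).
  rewrite size_nseq; under eq_fun do rewrite all_predT.
  rewrite expect_cst ?progeny_brood// => sum1.
  rewrite -[RHS]/(true%:R : R) sum1; apply: eq_bigr => k _.
  rewrite (_ : [set x | _] = setT); last by apply/seteqP; split.
  by rewrite probability_setT mulr1.
(* Averaging over the brood size: the pairs with [p n k = 0], on which (GT) is silent, have no
   weight in the sum. *)
have all_ge eta n (b : forall k, set (k.-tuple R)) :
    (forall k, p n k != 0 -> ((1 - eta)%:E <= G n k (b k))%E) ->
    (forall k, measurable (b k)) ->
    1 - eta <= \sum_(1 <= k < k0.+1) p n k * fine (G n k (b k)).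
  move=> Gb mb; rewrite -[leLHS]mul1r -[X in X * _ <= _](p_sum n) big_distrl/= !big_nat.
  apply: ler_sum => k /andP[k1 _].
  have [->|pk] := eqVneq (p n k) 0; first by rewrite !mul0r.
  rewrite ler_wpM2l ?p_ge0// -lee_fin fineK; first exact: Gb.
  by apply: fin_num_measure; exact: mb.
have mu_tight eta : 0 < eta -> exists2 B : R, 0 < B &
    forall m, 1 - eta <= expect k0 (mu m) (low_brood B) /\
              1 - eta <= expect k0 (mu m) (high_brood B).
  move=> /GT[B B0 HB]; exists B => // m.
  have mlow : measurable_fun setT (fun y : R => - B <= y).
    by apply: measurable_fun_ler => //; exact: measurable_cst.
  have mhigh := @measurable_ler R B.
  rewrite /low_brood /high_brood !expect_all// size_nseq; split.
    apply: (all_ge eta m (fun k => [set x : k.-tuple R | forall i, - B <= tnth x i])) => k.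
      by move=> /HB[].
    exact: (@measurable_all_tuple R _ k mlow).
  apply: (all_ge eta m (fun k => [set x : k.-tuple R | forall i, tnth x i <= B])) => k.
    by move=> /HB[].
  exact: (@measurable_all_tuple R _ k mhigh).
move=> eps eps_gt0.
(* The bound [2 e <= eps] controls the two tails together, and [e < 1/2] forces the median into the
   interval of radius [D] around [x]. *)
pose e : R := Num.min (eps / 2) 4^-1.
have e0 : 0 < e by rewrite lt_min divr_gt0//= invr_gt0.
have e4 : e <= 4^-1 by rewrite ge_min lexx orbT.
have e_eps : e <= eps / 2 by rewrite ge_min lexx.
have e01 : 0 < e < 1 by rewrite e0/=; lra.
have [D D0 conc] := cascade_concentrated k0_gt0 m0_gt1 a_gt0 mu_reg mu_tight e01.
(* The unknown centre [x] disappears here: the median and, with high probability, the maximum lie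
   within [D] of it, hence within [2 D] of each other. *)
exists `[- (2 * D), 2 * D]%classic; first exact: segment_compact.
move=> n; have [x [xup xlow]] := conc n 0%N.
pose u := cascade k0 mu n 0.
have uE y : P [set w | max_position Z n w <= y] = (1 - u y)%:E.
  rewrite -(max_cascade Z B1 n [::] y); congr (P _).
  by apply/seteqP; split => w /= /max_position_sub_max.
have mle y : measurable [set w | max_position Z n w <= y].
  have := @measurable_max_position _ _ _ _ _ _ Z n measurableT _ (measurable_itv `]-oo, y]).
  by rewrite setTI; congr measurable; apply/seteqP; split => w /=; rewrite in_itv.
have cdfE y : cdf (max_position Z n : {RV P >-> R}) y = (1 - u y)%:E.
  rewrite -uE; congr (P _).
have u_ni := (tail_cascade (fun m => law_brood (mu_reg m)) n 0).1.
set med := median P (max_position Z n).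
have med_lb y : ((2^-1)%:E <= cdf (max_position Z n : {RV P >-> R}) y)%E -> x - D <= y.
  rewrite cdfE lee_fin => uy; rewrite leNgt; apply/negP => yx.
  by have := u_ni _ _ (ltW yx); rewrite -/u in uy xlow *; lra.
have med_in : ((2^-1)%:E <= cdf (max_position Z n : {RV P >-> R}) (x + D)%R)%E.
  by rewrite cdfE lee_fin; rewrite -/u in xup; lra.
have med1 : med <= x + D.
  by apply: ge_inf; [exists (x - D) => y /med_lb|exact: med_in].
have med2 : x - D <= med.
  by apply: lb_le_inf; [exists (x + D); exact: med_in|move=> y /med_lb].
pose E := [set w | x - D < max_position Z n w <= x + D].
have EE : E = [set w | max_position Z n w <= x + D] `\` [set w | max_position Z n w <= x - D].
  apply/seteqP; split => w; rewrite /E /=.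
    by move=> /andP[xw wx]; split => //; apply/negP; rewrite -ltNge.
  by move=> [wx /negP]; rewrite -ltNge => xw; rewrite xw.
have mE : measurable E by rewrite EE; exact: measurableD.
have PE : ((1 - eps)%:E <= P E)%E.
  have -> : P E = (P [set w | (max_position Z n w <= x + D)%R] -
      P [set w | (max_position Z n w <= x - D)%R])%E.
    rewrite EE measureD//; last by rewrite -ge0_fin_numE// fin_num_measure.
    by rewrite setIidr// => w /= /le_trans; apply; lra.
  by rewrite !uE -EFinB lee_fin; rewrite -/u in xup xlow; lra.
apply: (le_trans PE); apply: le_measure; rewrite ?inE//.
  rewrite -[X in measurable X]setTI.
  by apply: (measurable_funPT (recentred P (max_position Z n))) => //; exact: measurable_itv.
move=> w /andP[w1 w2].
suff : - (2 * D) <= max_position Z n w - med <= 2 * D by rewrite /= in_itv.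
by apply/andP; split; lra.
Qed.
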